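(* Let $k$ be a field, $n\le m$, $R=k[x_{ij}\mid 1\le i\le n,\ 1\le j\le m]$, and let $M=(x_{ij})$ be the $n\times m$ matrix of variables. Let $<$ be any term order on $R$ and let $\Delta$ be an $(n-1)$-dimensional pure simplicial complex on the vertex set $[m]=\{1,\dots,m\}$. Then the linear strand of the rainbow determinantal facet ideal $\operatorname{rain}_<(J_\Delta)$ is supported on a regular CW complex. In particular, if $\operatorname{rain}_<(J_\Delta)$ has a linear resolution, then $\operatorname{rain}_<(J_\Delta)$ has a CW resolution, i.e. its minimal free resolution is supported on a regular CW complex.
   Context: For an $n$-subset $\mathbf a=\{a_1<\dots<a_n\}$ of $[m]$, $[\mathbf a]$ denotes the maximal minor of $M$ on the columns $a_1,\dots,a_n$, and $\operatorname{in}_<([\mathbf a])$ its lead monomial. The rainbow determinantal facet ideal (rainbow DFI) is $$\operatorname{rain}_<(J_\Delta)=\big(\operatorname{in}_<([\mathbf a])\ \big|\ \mathbf a \text{ is a facet of }\Delta\big)\subseteq R .$$ Linear strand: if $F_\bullet$ is the minimal graded free resolution of a module with initial degree $d$ (so $F_0$ has initial degree $d$), its linear strand $F_\bullet^{\mathrm{lin}}$ is the subcomplex whose $i$-th term is the free summand of $F_i$ generated in degree $d+i$, with the restricted differential. Supported on a regular CW complex: let $\mathcal P$ be a finite regular CW complex with incidence function $\epsilon$ (values in $\{0,\pm1\}$), whose vertices $v$ are labelled by monomials $m_v$; label each face $P$ by $m_P=\operatorname{lcm}(m_v\mid v\in V(P))$, where $V(P)$ is the vertex set of $P$. The associated complex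 has a free basis element $e_P$ of multidegree $m_P$ for each face $P$ (for an ideal, faces of dimension $i$ lie in homological degree $i$; vertices correspond to the generators $m_v$), with differential $e_P\mapsto\sum_{Q}\epsilon(Q,P)\frac{m_P}{m_Q}e_Q$, sum over codimension-one faces $Q$ of $P$. A complex is supported on $\mathcal P$ if it is isomorphic to such a complex. A CW resolution is a minimal free resolution supported on a regular CW complex. *)

(* Defs.v *)
From HB Require Import structures.
From mathcomp Require Import all_boot all_order all_algebra.
From mathcomp Require Import boolp classical_sets reals topology.
From mathcomp Require Import mpoly.

Set Implicit Arguments.
Unset Strict Implicit.
Unset Printing Implicit Defensive.

Import GRing.Theory Num.Theory numFieldTopology.Exports.

Local Open Scope classical_set_scope.
Local Open Scope ring_scope.

Section RegularCW.
Variable R : realType.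

Definition norm2 d (x : 'rV[R]_d) : R := \sum_(i < d) x 0 i ^+ 2.
Definition cball d : set 'rV[R]_d := [set x | norm2 x <= 1].
Definition oball d : set 'rV[R]_d := [set x | norm2 x < 1].
Definition usphere d : set 'rV[R]_d := [set x | norm2 x = 1].

Definition homeo_between (T U : topologicalType) (A : set T) (B : set U)
    (f : T -> U) : Prop :=
  exists g : U -> T,
    [/\ {within A, continuous f}, {within B, continuous g},
        f @` A = B, g @` B = A &
        {in A, cancel f g} /\ {in B, cancel g f}].

(* With finitely many cells, closure-finiteness and the weak-topology axiom are
   automatic; regularity is the requirement that each characteristic map be a
   homeomorphism of the closed ball onto the closed cell. *)
Record regularCW := RegularCW {
  space : topologicalType;
  cell : finType;
  cdim : cell -> nat;
  ocell : cell -> set space;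
  cw_hausdorff : hausdorff_space space;
  cw_disjoint : forall P Q x, ocell P x -> ocell Q x -> P = Q;
  cw_cover : forall x, exists P, ocell P x;
  cw_char : forall P, exists f : 'rV[R]_(cdim P) -> space,
    [/\ homeo_between (@cball (cdim P)) (closure (ocell P)) f,
        f @` @oball (cdim P) = ocell P &
        f @` @usphere (cdim P) `<=`
          [set x | exists2 Q, (cdim Q < cdim P)%N & ocell Q x]]
}.

Definition face (X : regularCW) (Q P : cell X) : Prop :=
  ocell Q `<=` closure (ocell P).

Definition codim1_face (X : regularCW) (Q P : cell X) : Prop :=
  face Q P /\ cdim P = (cdim Q).+1.

(* The last clause is the codimension-two condition with the empty face at the
   bottom, where the incidence of the empty face in every vertex is 1. *)
Definition incidence (X : regularCW) (eps : cell X -> cell X -> int) : Prop :=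
  [/\ forall Q P, eps Q P \in [:: 0; 1; -1],
      forall Q P, eps Q P != 0 <-> codim1_face Q P,
      forall E Q1 Q2 P, Q1 <> Q2 ->
        codim1_face E Q1 -> codim1_face E Q2 -> codim1_face Q1 P -> codim1_face Q2 P ->
        eps Q1 P * eps E Q1 + eps Q2 P * eps E Q2 = 0 &
      forall v w P, v <> w -> cdim v = 0%N -> cdim w = 0%N ->
        codim1_face v P -> codim1_face w P -> eps v P + eps w P = 0].

End RegularCW.

Section GradedComplexes.
Variables (k : fieldType) (N : nat).
Local Notation S := {mpoly k[N]}.

(* Data of an augmented sequence  ... -> F_1 -> F_0 -> S  of finite graded free
   modules with chosen homogeneous bases: the basis element p of F_i has degree
   gdeg p, is sent by the differential to the combination of the basis elements
   q of F_(i-1) with coefficients dif p q, and, for i = 0, is augmented to aug p. *)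
Record gfree := GFree {
  bas : nat -> finType;
  gdeg : forall i, bas i -> nat;
  dif : forall i, bas i.+1 -> bas i -> S;
  aug : bas 0 -> S
}.

Definition homog_entry (f : S) (a b : nat) : Prop :=
  f = 0 \/ (b <= a)%N /\ f \is (a - b).-homog.

Definition dmap (F : gfree) i (v : {ffun bas F i.+1 -> S}) :
    {ffun bas F i -> S} := [ffun q => \sum_p v p * dif p q].

Definition augmap (F : gfree) (v : {ffun bas F 0 -> S}) : S :=
  \sum_p v p * aug p.

Definition graded (F : gfree) : Prop :=
  (forall i (p : bas F i.+1) (q : bas F i),
     homog_entry (dif p q) (gdeg p) (gdeg q)) /\
  (forall p : bas F 0, homog_entry (aug p) (gdeg p) 0).

Definition exact_resolution (I : S -> Prop) (F : gfree) : Prop :=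
  [/\ forall f, I f <-> exists v : {ffun bas F 0 -> S}, augmap v = f,
      forall v : {ffun bas F 0 -> S},
        augmap v = 0 <-> exists w : {ffun bas F 1 -> S}, dmap w = v &
      forall i (v : {ffun bas F i.+1 -> S}),
        dmap v = 0 <-> exists w : {ffun bas F i.+2 -> S}, dmap w = v].

Definition minimal (F : gfree) : Prop :=
  forall i (p : bas F i.+1) (q : bas F i), (dif p q)@_0%MM = 0.

Definition minimal_graded_resolution (I : S -> Prop) (F : gfree) : Prop :=
  [/\ graded F, exact_resolution I F & minimal F].

Definition initial_degree (I : S -> Prop) (d : nat) : Prop :=
  (exists f, [/\ I f, f != 0 & f \is d.-homog]) /\
  (forall e f, I f -> f != 0 -> f \is e.-homog -> (d <= e)%N).

Definition linear_strand (d : nat) (F : gfree) : gfree :=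
  {| bas i := {p : bas F i | gdeg p == (d + i)%N};
     gdeg i p := gdeg (val p);
     dif i p q := dif (val p) (val q);
     aug p := aug (val p) |}.

Definition has_linear_resolution (I : S -> Prop) : Prop :=
  exists F d, [/\ minimal_graded_resolution I F, initial_degree I d &
    forall i (p : bas F i), gdeg p = (d + i)%N].

(* Isomorphism of augmented complexes of graded free modules, by mutually
   inverse matrices; compatibility with the augmentation is what makes the
   vertices of a supporting complex correspond to the generators of the ideal. *)
Definition gfree_iso (F G : gfree) : Prop :=
  exists (phi : forall i, bas F i -> bas G i -> S)
         (psi : forall i, bas G i -> bas F i -> S),
  [/\ forall i p q, homog_entry (phi i p q) (gdeg p) (gdeg q),
      forall i p p', \sum_q phi i p q * psi i q p' = (p == p')%:R,
      forall i q q', \sum_p psi i q p * phi i p q' = (q == q')%:R,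
      forall i (p : bas F i.+1) (q' : bas G i),
        \sum_q dif p q * phi i q q' = \sum_p' phi i.+1 p p' * dif p' q' &
      forall p : bas F 0, aug p = \sum_q phi 0%N p q * aug q].

Variable R : realType.

Section Cellular.
Variables (X : regularCW R) (eps : cell X -> cell X -> int).
(* Only the values of lab on the 0-cells are used. *)
Variable lab : cell X -> 'X_{1..N}.

Definition label (P : cell X) : 'X_{1..N} :=
  \big[@mlcm N/0%MM]_(v | (cdim v == 0%N) && `[< face v P >]) lab v.

(* The incidence function vanishes off the codimension-one faces, so the
   differential is a sum over these; on them the truncated subtraction of
   exponents is exact. *)
Definition cellular : gfree :=
  {| bas i := {P : cell X | cdim P == i};
     gdeg i P := mdeg (label (val P));
     dif i P Q := (eps (val Q) (val P))%:~R *
                  'X_[(label (val P) - label (val Q))%MM];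
     aug v := 'X_[label (val v)] |}.

End Cellular.

Definition supported_on_regularCW (F : gfree) : Prop :=
  exists (X : regularCW R) (eps : cell X -> cell X -> int)
         (lab : cell X -> 'X_{1..N}),
    incidence eps /\ gfree_iso (cellular eps lab) F.

Definition has_CW_resolution (I : S -> Prop) : Prop :=
  exists F, minimal_graded_resolution I F /\ supported_on_regularCW F.

End GradedComplexes.

Section SimplicialComplexes.
Variable T : finType.
Implicit Type D : {set {set T}}.

(* T is the ambient vertex set; its singletons need not all be faces. *)
Definition simplicial_complex D : Prop :=
  finset.set0 \in D /\ forall a b : {set T}, b \subset a -> a \in D -> b \in D.

Definition facet D (a : {set T}) : bool := finset.maxset (mem D) a.

Definition pure D : Prop :=
  forall a b, facet D a -> facet D b -> #|a| = #|b|.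

(* The dimension of D is dim1 D - 1. *)
Definition dim1 D : nat := \max_(a in D) #|a|.

End SimplicialComplexes.

Section RainbowIdeal.
Variables (k : fieldType) (n m : nat).
Local Notation S := {mpoly k[n * m]}.
Variable le : rel 'X_{1..(n * m)}.

Definition term_order : Prop :=
  [/\ reflexive le, antisymmetric le, transitive le, total le &
      (forall u, le 0%MM u) /\
      (forall u v w, le u v -> le (u + w)%MM (v + w)%MM)].

(* 0%MM is the least monomial, hence neutral for this maximum. *)
Definition lead_monomial (f : S) : 'X_{1..(n * m)} :=
  \big[(fun u v => if le u v then v else u)/0%MM]_(u <- msupp f) u.

Definition generic_matrix : 'M[S]_(n, m) :=
  \matrix_(i < n, j < m) 'X_(mxvec_index i j).

(* enum_val lists a increasingly; conform_mx only casts the n x #|a| submatrix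
   to a square one, so minor a is meaningful when #|a| = n. *)
Definition minor (a : {set 'I_m}) : S :=
  \det (conform_mx (0 : 'M_n)
          (colsub (enum_val : 'I_#|a| -> 'I_m) generic_matrix)).

Definition rain (D : {set {set 'I_m}}) (f : S) : Prop :=
  exists c : {set 'I_m} -> S,
    f = \sum_(a | facet D a) c a * 'X_[lead_monomial (minor a)].

End RainbowIdeal.

(* Main.v *)
(* The lead monomial of a maximal minor is one of the terms of its expansion, so it
   contains exactly one variable from every row of the matrix: the ideal is generated
   by monomials of the form x_{1 g(1)} ... x_{n g(n)}. The ideal generated by all of
   these is the product of the ideals (x_{i1}, ..., x_{im}), whose minimal resolution
   is supported on a product of n simplices, with cells the sets A of variables meeting
   every row and with squarefree label of degree n + dim A. The linear strand of a
   subideal is supported on the subcomplex X of those cells all of whose vertices are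
   generators, whatever the term order. Indeed the linear strand of any minimal
   resolution is determined up to isomorphism by two properties: its generators are a
   k-basis of the degree n part of the ideal, and its syzygies in every further step
   are a k-basis of the cycles with linear coefficients; both hold for the cellular
   complex of X by comparing coefficients.

   X is realised in coordinates: one coordinate for each variable, nonnegative, with
   sum 1 in each row and with support a cell. A closed cell is a polytope, and rescaling
   along rays from its barycentre turns it into a Euclidean ball. *)
Require Import Defs.
From HB Require Import structures.
From mathcomp Require Import all_boot all_order all_algebra.
From mathcomp Require Import boolp classical_sets functions reals topology.
From mathcomp Require Import -(notations) normedtype realfun.
From mathcomp Require Import fintype finset fingroup perm zmodp mpoly.
From mathcomp Require Import ring zify.

Set Implicit Arguments.
Unset Strict Implicit.
Unset Printing Implicit Defensive.

Import Order.TTheory GRing.Theory Num.Theory numFieldTopology.Exports.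
Import numFieldNormedType.Exports.

(** * Rainbow cells *)

Section Cells.
Variables (N n : nat) (r : 'I_N -> 'I_n) (Phi : {set {set 'I_N}}).
Implicit Types (A B T : {set 'I_N}) (a b : 'I_N).

Definition hits A : bool := [forall i, [exists a in A, r a == i]].

(** Sets [T] with [hits T] and [#|T| == n] are transversals, one variable per row: they are the
    vertices of the product of simplices, and [Phi] stands for the generators among them. *)
Definition valid A : bool :=
  hits A && [forall T : {set 'I_N},
    [&& hits T, #|T| == n & T \subset A] ==> (T \in Phi)].

Lemma hitsP A : reflect (forall i, exists2 a, a \in A & r a = i) (hits A).
Proof.
apply: (iffP forallP) => H i.
  by have /exists_inP[a aA /eqP] := H i; exists a.
by have [a aA ai] := H i; apply/exists_inP; exists a => //; apply/eqP.
Qed.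

Lemma valid_hits A : valid A -> hits A.
Proof. by case/andP. Qed.

Lemma valid_transversal A T :
  valid A -> hits T -> #|T| = n -> T \subset A -> T \in Phi.
Proof.
by case/andP=> _ /forallP/(_ T)/implyP HA hT cT sT; apply: HA; rewrite hT cT eqxx.
Qed.

Lemma validP A : hits A ->
  (forall T, hits T -> #|T| = n -> T \subset A -> T \in Phi) -> valid A.
Proof.
move=> hA HA; rewrite /valid hA; apply/forallP => T; apply/implyP.
by case/and3P=> hT /eqP cT sT; exact: HA.
Qed.

Lemma hitsS A B : A \subset B -> hits A -> hits B.
Proof.
move=> sAB /hitsP hA; apply/hitsP => i; have [a aA ai] := hA i.
by exists a => //; exact: (subsetP sAB).
Qed.

Lemma validS A B : B \subset A -> hits B -> valid A -> valid B.
Proof.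
move=> sBA hB vA; apply: validP => // T hT cT sT.
by apply: valid_transversal vA _ _ _ => //; exact: subset_trans sBA.
Qed.

(** The pivots, one for each row, form a transversal of [A]; the remaining elements of [A] will
    serve as free coordinates on its cell. *)
Definition piv A a : 'I_N := [arg min_(b < a | (b \in A) && (r b == r a)) (b : nat)].

Lemma pivP A a : a \in A -> [/\ piv A a \in A, r (piv A a) = r a &
  forall b, b \in A -> r b = r a -> (piv A a <= b)%N].
Proof.
move=> aA; rewrite /piv; case: arg_minnP => [|b /andP[bA /eqP rb] H].
  by rewrite aA eqxx.
by split=> // c cA rc; apply: H; rewrite cA rc eqxx.
Qed.

Lemma eq_piv A a b : a \in A -> b \in A -> r a = r b -> piv A a = piv A b.
Proof.
move=> /pivP[pA rp pm] /pivP[pA' rp' pm'] rab; apply/val_inj/anti_leq.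
by rewrite pm ?pm' ?rp ?rp'.
Qed.

Lemma piv_piv A a : a \in A -> piv A (piv A a) = piv A a.
Proof. by move=> aA; have [pA rp _] := pivP aA; exact: eq_piv. Qed.

Definition nonpiv A : {set 'I_N} := [set a in A | piv A a != a].

(** Pivots correspond bijectively to rows. This is the dimension formula for a product of simplices
    with [#|A|] vertices in its [n] factors altogether. *)
Lemma card_nonpiv A : hits A -> (#|nonpiv A| + n)%N = #|A|.
Proof.
move=> /hitsP hA; pose B := [set a in A | piv A a == a].
have <- : #|B| = n.
  rewrite -[RHS](card_ord n) -cardsT -(_ : r @: B = setT); last first.
    apply/setP => i; rewrite inE; apply/imsetP; have [a aA <-] := hA i.
    have [pA rp _] := pivP aA.
    by exists (piv A a) => //; rewrite inE pA piv_piv // eqxx.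
  rewrite card_in_imset // => a b; rewrite !inE => /andP[aA /eqP pa] /andP[bA /eqP pb].
  by move=> rab; rewrite -pa -pb; exact: eq_piv.
rewrite -cardsUI; have -> : nonpiv A :&: B = set0.
  by apply/setP => a; rewrite !inE; case: (piv A a == a); rewrite ?andbF.
rewrite cards0 addn0; apply: eq_card => a; rewrite !inE.
by case: (a \in A); rewrite //= orNb.
Qed.

End Cells.

(** * Gauges and rescaling *)

Section Gauges.
Local Open Scope classical_set_scope.
Local Open Scope ring_scope.
Variable R : realType.

Lemma continuous_row (T : topologicalType) d (f : T -> 'rV[R]_d) :
  (forall j, continuous (fun x => f x 0 j)) -> continuous f.
Proof.
move=> fc x B [P HP sPB].
suff : \near x, forall i j, P i j (f x i j).
  by apply: filterS => y Py; exact: sPB.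
apply: filter_forall => i; apply: filter_forall => j.
by rewrite ord1; apply: (fc j x); rewrite -(ord1 i); exact: HP.
Qed.

Lemma continuous_sum (T : topologicalType) (I : Type) (s : seq I) (P : pred I)
    (f : I -> T -> R) :
  (forall i, continuous (f i)) -> continuous (fun x => \sum_(i <- s | P i) f i x).
Proof.
move=> fc; elim: s => [|i s IH] x.
  by under eq_fun do rewrite big_nil; exact: cst_continuous.
under eq_fun do rewrite big_cons.
case: (P i); last exact: IH.
by apply: (@continuousD _ R^o) ; [exact: fc | exact: IH].
Qed.

Lemma continuous_bigmax (T : topologicalType) (I : Type) (s : seq I) (P : pred I)
    (f : I -> T -> R) :
  (forall i, continuous (f i)) ->
  continuous (fun x => \big[Num.max/0]_(i <- s | P i) f i x).
Proof.
move=> fc; elim: s => [|i s IH] x.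
  by under eq_fun do rewrite big_nil; exact: cst_continuous.
under eq_fun do rewrite big_cons.
case: (P i); last exact: IH.
by apply: (@continuous_max R T (f i)); [exact: fc | exact: IH].
Qed.

(** Modelled on the Minkowski functional of a compact body around the origin; the last clause makes
    the body bounded, and so [p] definite. *)
Definition gauge d (p : 'rV[R]_d -> R) : Prop :=
  [/\ continuous p, forall v, 0 <= p v,
      forall t v, 0 <= t -> p (t *: v) = t * p v &
      exists C, forall (v : 'rV[R]_d) j, `|v 0 j| <= C * p v].

(* At v = 0 the quotient is 0 / 0 = 0, which does no harm. *)
Definition rescale d (q p : 'rV[R]_d -> R) (v : 'rV[R]_d) : 'rV[R]_d :=
  (q v / p v) *: v.

Lemma gauge0 d (p : 'rV[R]_d -> R) : gauge p -> p 0 = 0.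
Proof. by case=> _ _ ph _; rewrite -(scale0r 0) ph ?mul0r. Qed.

Lemma gauge_eq0 d (p : 'rV[R]_d -> R) v : gauge p -> (p v == 0) = (v == 0).
Proof.
move=> pg; apply/eqP/eqP => [pv0|->]; last exact: gauge0.
case: pg => _ _ _ [C HC]; apply/rowP => j; rewrite mxE.
by apply/normr0_eq0/le_anti; rewrite normr_ge0 (le_trans (HC v j)) // pv0 mulr0.
Qed.

(** Consequently [rescale q p] maps the unit ball of [q] into that of [p], open ball to open ball
    and sphere to sphere. *)
Lemma gauge_rescale d (q p : 'rV[R]_d -> R) v : gauge q -> gauge p ->
  p (rescale q p v) = q v.
Proof.
move=> qg pg; have [v0|v0] := eqVneq v 0.
  by rewrite /rescale v0 scaler0 !gauge0.
case: (pg) (qg) => _ p0 ph _ [_ q0 _ _].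
by rewrite /rescale ph ?divr_ge0// divfK // gauge_eq0.
Qed.

Lemma rescaleK d (q p : 'rV[R]_d -> R) : gauge q -> gauge p ->
  cancel (rescale q p) (rescale p q).
Proof.
move=> qg pg v; have [v0|v0] := eqVneq v 0; first by rewrite /rescale v0 !scaler0.
rewrite {1}/rescale gauge_rescale // {2}/rescale scalerA {1}/rescale.
case: (pg) (qg) => _ p0 _ _ [_ q0 qh _].
rewrite qh ?divr_ge0// -[RHS]scale1r; congr (_ *: _).
have qv : q v != 0 by rewrite gauge_eq0.
have pv : p v != 0 by rewrite gauge_eq0.
by field; rewrite qv pv.
Qed.

(** Away from the origin this is a quotient of continuous functions. At the origin the bound
    [|v 0 j| <= C * p v] confines each coordinate between [- C * q v] and [C * q v], which tend to
    0. *)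
Lemma continuous_rescale d (q p : 'rV[R]_d -> R) : gauge q -> gauge p ->
  continuous (rescale q p).
Proof.
move=> qg pg; apply: continuous_row => j v.
case: (pg) (qg) => pc p0 ph [C HC] [qc q0 _ _].
under eq_fun do rewrite mxE.
have [->|v0] := eqVneq v 0; last first.
  apply: (@continuousM R _ (fun w => q w / p w) (fun w : 'rV_d => w 0 j)).
    apply: (@continuousM R _ q (fun w => (p w)^-1)); first exact: qc.
    by apply: (@continuousV R _ p); [rewrite gauge_eq0 | exact: pc].
  exact: coord_continuous.
rewrite mxE mulr0.
have Cq D : (fun w => D * q w) w @[w --> (0 : 'rV[R]_d)] --> (0 : R).
  have -> : (0 : R) = D * q 0 by rewrite gauge0 // mulr0.
  by apply: (@continuousM R _ (fun=> D) q); [exact: cst_continuous | exact: qc].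
apply: (@squeeze_cvgr _ (nbhs (0 : 'rV[R]_d)) _ R _ _ _ _ 0 (Cq (- C)) (Cq C)).
near=> w; rewrite mulNr -ler_norml normrM ger0_norm ?divr_ge0//.
have [w0|w0] := eqVneq w 0; first by rewrite w0 mxE normr0 mulr0 gauge0// mulr0.
have pw : 0 < p w by rewrite lt_neqAle p0 eq_sym gauge_eq0 // w0.
rewrite -mulrA [C * _]mulrC ler_wpM2l // mulrC ler_pdivrMr.
Unshelve. all: by end_near. Qed.

Lemma gauge_norm2 d : gauge (fun v : 'rV[R]_d => Num.sqrt (norm2 v)).
Proof.
split.
- move=> v; apply: (@continuous_comp _ _ _ (@norm2 R d)); last exact: sqrt_continuous.
  apply: continuous_sum => j w.
  under eq_fun do rewrite expr2.
  by apply: (@continuousM R _ (fun w : 'rV_d => w 0 j) (fun w : 'rV_d => w 0 j));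
    exact: coord_continuous.
- by move=> v; exact: sqrtr_ge0.
- move=> t v t0; have -> : norm2 (t *: v) = t ^+ 2 * norm2 v.
    by rewrite /norm2 mulr_sumr; apply: eq_bigr => j _; rewrite mxE exprMn.
  by rewrite sqrtrM ?sqr_ge0// sqrtr_sqr ger0_norm.
- exists 1 => v j; rewrite mul1r -sqrtr_sqr ler_wsqrtr // /norm2 (bigD1 j) //=.
  by rewrite lerDl sumr_ge0 // => i _; rewrite sqr_ge0.
Qed.

Lemma sqrt_norm2_le1 d (v : 'rV[R]_d) : (Num.sqrt (norm2 v) <= 1) = (norm2 v <= 1).
Proof. by rewrite -{1}sqrtr1 ler_sqrt. Qed.

Lemma sqrt_norm2_lt1 d (v : 'rV[R]_d) : (Num.sqrt (norm2 v) < 1) = (norm2 v < 1).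
Proof. by rewrite -{1}sqrtr1 ltr_sqrt. Qed.

End Gauges.

(** * Geometric realization *)

Section Charts.
Local Open Scope classical_set_scope.
Local Open Scope ring_scope.
Variables (R : realType) (N n : nat) (r : 'I_N -> 'I_n) (A : {set 'I_N}).
Hypothesis hA : hits r A.

Definition supp (x : 'rV[R]_N) : {set 'I_N} := [set a | x 0 a != 0]%SET.

Local Notation d := #|nonpiv r A|.
Local Notation q := (@enum_val _ (mem (nonpiv r A)) : 'I_d -> 'I_N).
Implicit Types (a b : 'I_N) (i : 'I_n) (j : 'I_d) (v : 'rV[R]_d) (x y : 'rV[R]_N).

Definition class_size a : nat := #|[set b in A | r b == r a]%SET|.

(** The barycentre of the closed cell: each row spreads its mass 1 evenly over its elements of
    [A]. *)
Definition centre : 'rV[R]_N :=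
  \row_a (if a \in A then (class_size a)%:R^-1 else 0).

(** Parametrises the linear space parallel to the cell by the basis $e_a - e_{piv(a)}$, with $a$
    running over the nonpivots. *)
Definition chart_lin v : 'rV[R]_N :=
  \row_a \sum_j v 0 j * ((a == q j)%:R - (a == piv r A (q j))%:R).

Definition coords x : 'rV[R]_d := \row_j x 0 (q j).

(** The Minkowski functional of the cell moved to its centre: with $c_a$ the size of the class of
    $a$, the condition $1/c_a + y_a \ge 0$ reads $-c_a y_a \le 1$. *)
Definition chart_gauge v : R :=
  \big[Num.max/0]_(a in A) (- ((class_size a)%:R * chart_lin v 0 a)).

Lemma sum_delta (P : pred 'I_N) b : \sum_(a | P a) (a == b)%:R = (P b)%:R :> R.
Proof.
case: (boolP (P b)) => Pb.
  by rewrite (bigD1 b) //= eqxx big1 ?addr0 // => a /andP[_ /negPf->].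
by rewrite big1 // => a Pa; case: eqP => // ab; rewrite -ab Pa in Pb.
Qed.

Lemma class_size_gt0 a : a \in A -> (0 < class_size a)%N.
Proof. by move=> aA; apply/card_gt0P; exists a; rewrite inE aA eqxx. Qed.

Lemma enum_nonpiv j : q j \in A /\ piv r A (q j) != q j.
Proof. by have := enum_valP j; rewrite inE => /andP. Qed.

Lemma chart_lin_coord v j : chart_lin v 0 (q j) = v 0 j.
Proof.
rewrite mxE (bigD1 j) //= eqxx; have [_ pj] := enum_nonpiv j.
rewrite eq_sym (negPf pj) subr0 mulr1 big1 ?addr0 // => l lj.
have [lA pl] := enum_nonpiv l.
rewrite (inj_eq enum_val_inj) eq_sym (negPf lj) sub0r.
case: eqP => [jp|_]; last by rewrite oppr0 mulr0.
by move: pj; rewrite jp piv_piv // eqxx.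
Qed.

Lemma chart_lin_off v a : a \notin A -> chart_lin v 0 a = 0.
Proof.
move=> aA; rewrite mxE big1 // => j _; have [jA _] := enum_nonpiv j.
have [pA _ _] := pivP r jA.
case: eqP => [aj|_]; first by rewrite aj jA in aA.
by case: eqP => [aj|_]; [rewrite aj pA in aA | rewrite subrr mulr0].
Qed.

Lemma chart_lin_sum v i : \sum_(a | r a == i) chart_lin v 0 a = 0.
Proof.
under eq_bigr do rewrite mxE.
rewrite exchange_big /= big1 // => j _; rewrite -mulr_sumr sumrB !sum_delta.
by have [jA _] := enum_nonpiv j; have [_ -> _] := pivP r jA; rewrite subrr mulr0.
Qed.

(** Both sides agree at the nonpivots and off [A]. Each row has a single pivot, where they agree
    because both rows sum to 0. *)
Lemma coordsK y : (forall a, a \notin A -> y 0 a = 0) ->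
  (forall i, \sum_(a | r a == i) y 0 a = 0) -> chart_lin (coords y) = y.
Proof.
move=> yA ysum.
have Hnp a : a \in nonpiv r A -> chart_lin (coords y) 0 a = y 0 a.
  move=> aN; rewrite -(enum_rankK_in aN aN) chart_lin_coord mxE.
  by [].
apply/rowP => a; case: (boolP (a \in A)) => aA; last by rewrite chart_lin_off // yA.
case: (boolP (a \in nonpiv r A)) => aN; first exact: Hnp.
have pa : piv r A a = a by apply/eqP; move: aN; rewrite inE aA negbK.
have : \sum_(b | r b == r a) (chart_lin (coords y) 0 b - y 0 b) = 0.
  by rewrite sumrB chart_lin_sum ysum subrr.
rewrite (bigD1 a) //= big1 ?addr0 => [/subr0_eq //|b /andP[/eqP rb ba]].
case: (boolP (b \in A)) => bA; last by rewrite chart_lin_off // yA // subrr.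
rewrite Hnp ?subrr // inE bA; apply: contra_neq ba => <-.
by rewrite -pa; exact: eq_piv.
Qed.

Lemma chart_linK : cancel chart_lin coords.
Proof. by move=> v; apply/rowP => j; rewrite mxE chart_lin_coord. Qed.

Lemma continuous_chart_lin a : continuous (fun v => chart_lin v 0 a).
Proof.
rewrite (_ : (fun v => _) = (fun v => \sum_j v 0 j *
    ((a == q j)%:R - (a == piv r A (q j))%:R))); last first.
  by apply/funext => v; rewrite mxE.
apply: continuous_sum => j w.
apply: (@continuousM R _ (fun w : 'rV_d => w 0 j)
  (fun=> (a == q j)%:R - (a == piv r A (q j))%:R)).
  exact: coord_continuous.
exact: cst_continuous.
Qed.

Lemma chart_linZ t v : chart_lin (t *: v) = t *: chart_lin v.
Proof.
by apply/rowP => a; rewrite !mxE mulr_sumr; apply: eq_bigr => j _; rewrite mxE mulrA.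
Qed.

Lemma centre_sum i : \sum_(a | r a == i) centre 0 a = 1.
Proof.
under eq_bigr do rewrite mxE.
have [b bA bi] := hitsP _ _ hA i.
rewrite -big_mkcondr /= (eq_bigr (fun=> (class_size b)%:R^-1)) => [|a /andP[/eqP ra _]].
  rewrite sumr_const (_ : #|_| = class_size b).
    by rewrite -[LHS]mulr_natr mulVf // pnatr_eq0 -lt0n class_size_gt0.
  by apply: eq_card => a; rewrite !inE unfold_in bi andbC.
by rewrite /class_size ra bi.
Qed.

Lemma chart_gauge_leP v s : 0 <= s ->
  (chart_gauge v <= s) <->
  (forall a, a \in A -> - s <= (class_size a)%:R * chart_lin v 0 a).
Proof.
move=> s0; split=> [/bigmax_leP[_ H] a aA|H].
  by rewrite lerNl; exact: H.
by apply/bigmax_leP; split=> // a aA; rewrite -lerNl; exact: H.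
Qed.

Lemma chart_gauge_ge0 v : 0 <= chart_gauge v.
Proof. exact: bigmax_ge_id. Qed.

Lemma chart_lin_ge v a : - chart_gauge v <= chart_lin v 0 a.
Proof.
case: (boolP (a \in A)) => aA; last first.
  by rewrite chart_lin_off // oppr_le0 chart_gauge_ge0.
have g0 := chart_gauge_ge0 v.
have /(_ (lexx _)) := iffLR (chart_gauge_leP v g0) => /(_ a aA) H.
have c1 : 1 <= (class_size a)%:R :> R by rewrite ler1n class_size_gt0.
have [l0|l0] := lerP 0 (chart_lin v 0 a).
  by rewrite (le_trans _ l0) // oppr_le0.
apply: le_trans H _; rewrite -[leRHS]mul1r.
by apply: ler_wnM2r => //; exact: ltW.
Qed.

Lemma gauge_chart : gauge chart_gauge.
Proof.
split.
- apply: continuous_bigmax => a v.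
  apply: (@continuousN R R^o _ (fun v => (class_size a)%:R * chart_lin v 0 a)).
  apply: (@continuousM R _ (fun=> (class_size a)%:R) (fun v => chart_lin v 0 a)).
    exact: cst_continuous.
  exact: continuous_chart_lin.
- exact: chart_gauge_ge0.
- move=> t v t0; rewrite /chart_gauge.
  rewrite (big_morph (fun s : R => t * s) (id1 := 0) (op1 := Num.max)) ?mulr0 //.
    by apply: eq_bigr => a _; rewrite chart_linZ mxE mulrN mulrCA.
  by move=> s u; rewrite maxr_pMr.
(* Each coordinate of [chart_lin v] is at least minus the gauge. Since its row sums to 0, it is
   minus the sum of the others, hence at most [N] times the gauge; the constant covers both
   bounds. *)
- exists (N%:R + 1) => v j; rewrite -chart_lin_coord; set a := q j.
  have g0 := chart_gauge_ge0 v.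
  have := chart_lin_sum v (r a); rewrite (bigD1 a) //= => /eqP.
  rewrite addr_eq0 -sumrN => /eqP ea.
  have lea : chart_lin v 0 a <= N%:R * chart_gauge v.
    rewrite ea (@le_trans _ _ (\sum_(b : 'I_N) chart_gauge v)) //.
      rewrite [leRHS](bigID (fun b => (r b == r a) && (b != a))) /=.
      rewrite -[leLHS]addr0 lerD ?sumr_ge0 // ler_sum // => b _.
      by rewrite lerNl chart_lin_ge.
    by rewrite sumr_const card_ord -[_ *+ _]mulr_natl.
  rewrite ler_norml; apply/andP; split.
    rewrite (le_trans _ (chart_lin_ge v a)) // lerN2 mulrDl mul1r lerDr.
    by rewrite mulr_ge0.
  by rewrite (le_trans lea) // mulrDl mul1r lerDl.
Qed.

End Charts.

(** * The realization as a regular CW complex *)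

Section Realization.
Local Open Scope classical_set_scope.
Local Open Scope ring_scope.

(** [insubd] gives a total map into the subtype, with a junk value where [h] leaves [S]; on [A] it
    is [h] itself, so continuity holds within [A]. *)
Lemma within_continuous_insubd (T U : topologicalType) (S : set U) (x0 : S)
    (A : set T) (h : T -> U) : continuous h -> (forall v, A v -> S (h v)) ->
  {within A, continuous (fun v => insubd x0 (h v) : S)}.
Proof.
move=> hc hS; apply/subspace_continuousP => v Av B [_ [[W oW <-] Wv sWB]].
have : \forall w \near v, W (h w).
  apply: hc; apply: open_nbhs_nbhs; split=> //.
  by move: Wv; rewrite /= set_valE insubdK //; exact/mem_set/hS.
rewrite /within /= => nW.
apply: filterS nW => w Ww Aw; apply: sWB => /=.
by rewrite set_valE insubdK //; exact/mem_set/hS.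
Qed.

(** Distinct points differ in a coordinate, and disjoint open sets of reals pull back along it. *)
Lemma hausdorff_subtype (R : realType) d (S : set 'rV[R]_d) : hausdorff_space S.
Proof.
rewrite open_hausdorff => x y xy.
have [j xyj] : exists j, val x 0 j != val y 0 j.
  apply/existsP; rewrite -negb_forall; apply: contra xy => /forallP H.
  by apply/eqP/val_inj/rowP => j; exact/eqP.
have := @Rhausdorff R; rewrite open_hausdorff.
move=> /(_ _ _ xyj)[[V W] /= [xV yW] [oV oW VW]].
have jc : continuous (fun z : S => val z 0 j).
  move=> z; apply: (@continuous_comp _ _ _ (@set_val _ S) (fun u : 'rV_d => u 0 j)).
    exact: initial_continuous.
  exact: coord_continuous.
exists ((fun z : S => val z 0 j) @^-1` V, (fun z : S => val z 0 j) @^-1` W) => /=.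
  by move: xV yW => /set_mem xV /set_mem yW; split; apply/mem_set.
split; [exact: open_comp | exact: open_comp |].
by rewrite -preimage_setI (eqP VW) preimage_set0.
Qed.

Variables (R : realType) (N n : nat) (r : 'I_N -> 'I_n) (Phi : {set {set 'I_N}}).

Definition realization : set 'rV[R]_N :=
  [set x : 'rV[R]_N | [/\ forall a, 0 <= x 0 a, forall i, \sum_(a | r a == i) x 0 a = 1 &
               valid r Phi (supp x)]].

Definition rcell := {A : {set 'I_N} | valid r Phi A}.

Definition rcdim (P : rcell) : nat := #|nonpiv r (val P)|.

Definition rocell (P : rcell) : set realization := [set x | supp (val x) = val P].

Section OneCell.
Variable P : rcell.
Let A : {set 'I_N} := val P.

Let hA : hits r A. Proof. exact: valid_hits (valP P). Qed.

Let nrm (v : 'rV[R]_(rcdim P)) := Num.sqrt (norm2 v).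
Let gau : 'rV[R]_(rcdim P) -> R := @chart_gauge R N n r A.

Let nrm_gauge : gauge nrm. Proof. exact: gauge_norm2. Qed.
Let gau_gauge : gauge gau. Proof. exact: gauge_chart. Qed.

Definition chart_map (v : 'rV[R]_(rcdim P)) : 'rV[R]_N :=
  centre R r A + chart_lin (rescale nrm gau v).

Definition chart_inv (x : 'rV[R]_N) : 'rV[R]_(rcdim P) :=
  rescale gau nrm (coords r A (x - centre R r A)).

Lemma centre_off a : a \notin A -> centre R r A 0 a = 0.
Proof. by move=> /negPf aA; rewrite mxE aA. Qed.

Lemma supp_centre : supp (centre R r A) = A.
Proof.
apply/setP => a; rewrite inE mxE; case: ifP => aA; last by rewrite eqxx.
by rewrite invr_eq0 pnatr_eq0 -lt0n class_size_gt0.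
Qed.

Let scale_centre (y : 'rV[R]_(rcdim P)) a : a \in A ->
  (class_size r A a)%:R * (centre R r A + chart_lin y) 0 a =
  1 + (class_size r A a)%:R * chart_lin y 0 a.
Proof.
move=> aA; have -> : (centre R r A + chart_lin y) 0 a =
  centre R r A 0 a + chart_lin y 0 a by rewrite mxE.
rewrite mulrDr; congr (_ + _).
by rewrite mxE aA mulfV // pnatr_eq0 -lt0n class_size_gt0.
Qed.

Let class_pos a : a \in A -> 0 < (class_size r A a)%:R :> R.
Proof. by move=> aA; rewrite ltr0n class_size_gt0. Qed.

(** Multiplied by the class size, the coordinate of the centre becomes 1, so nonnegativity on [A] is
    the gauge bound; off [A] the coordinates vanish. *)
Let chart_ge0 (y : 'rV[R]_(rcdim P)) :
  gau y <= 1 <-> forall a, 0 <= (centre R r A + chart_lin y) 0 a.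
Proof.
rewrite /gau chart_gauge_leP //; split=> H a.
  case: (boolP (a \in A)) => aA; last by rewrite mxE centre_off // chart_lin_off // addr0.
  by rewrite -(pmulr_rge0 _ (class_pos aA)) scale_centre // -lerBlDl sub0r H.
by move=> aA; rewrite -[leLHS]sub0r lerBlDl -scale_centre // pmulr_rge0 // class_pos.
Qed.

Let chart_gt0 (y : 'rV[R]_(rcdim P)) :
  gau y < 1 <-> forall a, a \in A -> 0 < (centre R r A + chart_lin y) 0 a.
Proof.
split=> [/bigmax_ltP[_ H] a aA|H].
  rewrite -(pmulr_rgt0 _ (class_pos aA)) scale_centre // -ltrBlDl sub0r.
  by rewrite ltrNl H.
apply/bigmax_ltP; split=> // a aA.
rewrite ltrNl -[ltLHS]sub0r ltrBlDl -scale_centre // pmulr_rgt0 ?class_pos //.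
exact: H.
Qed.

Let chart_sum (y : 'rV[R]_(rcdim P)) i :
  \sum_(a | r a == i) (centre R r A + chart_lin y) 0 a = 1.
Proof.
under eq_bigr do rewrite mxE.
by rewrite big_split /= centre_sum // chart_lin_sum addr0.
Qed.

Let chart_supp (y : 'rV[R]_(rcdim P)) : supp (centre R r A + chart_lin y) \subset A.
Proof.
apply/fintype.subsetP => a; rewrite inE; apply: contra_neqT => aA.
by rewrite mxE centre_off // chart_lin_off // addr0.
Qed.

Lemma hits_supp (x : 'rV[R]_N) :
  (forall i, \sum_(a | r a == i) x 0 a = 1) -> hits r (supp x).
Proof.
move=> xsum; apply/hitsP => i; have := xsum i.
have [/exists_inP[a aS /eqP ai] _|/exists_inPn H] :=
  boolP [exists a in supp x, r a == i]; first by exists a.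
rewrite big1 => [/esym/eqP|a /eqP ai]; first by rewrite oner_eq0.
by apply/eqP; apply: contraTT (eqxx i) => xa; rewrite -{1}ai H // inE.
Qed.

Lemma chart_mapP v : cball v ->
  realization (chart_map v) /\ supp (chart_map v) \subset A.
Proof.
move=> v1; split; last exact: chart_supp.
split; [|exact: chart_sum|].
  by apply/chart_ge0; rewrite /gau gauge_rescale // sqrt_norm2_le1.
apply: validS (valP P); first exact: chart_supp.
exact/hits_supp/chart_sum.
Qed.

Lemma chart_invK x : realization x -> supp x \subset A -> chart_map (chart_inv x) = x.
Proof.
move=> [_ xsum _] xA; rewrite /chart_map rescaleK // coordsK //.
- by rewrite addrC subrK.
- move=> a aA; rewrite !mxE (negPf aA) subr0.
  by apply/eqP; apply: contraNT aA => xa; apply: (fintype.subsetP xA); rewrite inE.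
- move=> i; rewrite (eq_bigr (fun a => x 0 a - centre R r A 0 a)).
    by rewrite sumrB xsum centre_sum // subrr.
  by move=> a _; rewrite !mxE.
Qed.

Lemma chart_mapK : cancel chart_map chart_inv.
Proof. by move=> v; rewrite /chart_inv /chart_map addrC addKr chart_linK ?rescaleK. Qed.

(** Strict inequality for the gauge means that every coordinate on [A] is positive, so the boundary
    of the ball consists of the points whose image loses support. *)
Lemma chart_map_open v : oball v <-> (cball v /\ supp (chart_map v) = A).
Proof.
have -> : oball v <-> gau (rescale nrm gau v) < 1.
  by rewrite /gau gauge_rescale // sqrt_norm2_lt1.
have -> : cball v <-> gau (rescale nrm gau v) <= 1.
  by rewrite /gau gauge_rescale // sqrt_norm2_le1.
rewrite chart_gt0 chart_ge0 -/(chart_map v); split=> [H|[H sA] a aA].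
  split=> [a|].
    case: (boolP (a \in A)) => aA; first exact/ltW/H.
    by rewrite mxE centre_off // chart_lin_off // addr0.
  apply/eqP; rewrite finset.eqEsubset chart_supp; apply/fintype.subsetP => a aA.
  by rewrite inE gt_eqF // H.
by rewrite lt_neqAle H andbT eq_sym; move: aA; rewrite -sA inE.
Qed.

Lemma chart_inv_ball x : realization x -> supp x \subset A -> cball (chart_inv x).
Proof.
move=> xr xA; rewrite /cball /= -sqrt_norm2_le1 -/(nrm _) gauge_rescale //.
apply/chart_ge0.
have <- : chart_map (chart_inv x) =
    centre R r A + chart_lin (coords r A (x - centre R r A)).
  by rewrite /chart_map rescaleK.
by rewrite chart_invK //; case: xr.
Qed.

Lemma continuous_chart_map : continuous chart_map.
Proof.
apply: continuous_row => a.
rewrite (_ : (fun v => _) = (fun v => centre R r A 0 a +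
  chart_lin (rescale nrm gau v) 0 a)); last by apply/funext => v; rewrite mxE.
move=> v; apply: (@continuousD R R^o _ (fun=> centre R r A 0 a)
  (fun v => chart_lin (rescale nrm gau v) 0 a)); first exact: cst_continuous.
apply: (@continuous_comp _ _ _ (rescale nrm gau) (fun y => chart_lin y 0 a)).
  exact: continuous_rescale.
exact: continuous_chart_lin.
Qed.

Lemma continuous_chart_inv : continuous chart_inv.
Proof.
move=> x; apply: (@continuous_comp _ _ _
    (fun x : 'rV[R]_N => coords r A (x - centre R r A)) (rescale gau nrm));
  last exact: continuous_rescale.
apply: continuous_row => j y.
rewrite (_ : (fun v => _) = (fun v : 'rV_N => v 0 (enum_val j) -
  centre R r A 0 (enum_val j))); last by apply/funext => v; rewrite !mxE.
apply: (@continuousB R R^o _ (fun v : 'rV_N => v 0 (enum_val j)));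
  [exact: coord_continuous | exact: cst_continuous].
Qed.

Lemma centre_realization : realization (centre R r A).
Proof.
split; last by rewrite supp_centre; exact: (valP P).
  by move=> a; rewrite mxE; case: ifP; rewrite ?invr_ge0.
by move=> i; exact: centre_sum.
Qed.

Definition base_point : realization := exist _ (centre R r A) (mem_set centre_realization).

Definition cell_map v : realization := insubd base_point (chart_map v).

Lemma val_cell_map v : cball v -> val (cell_map v) = chart_map v.
Proof. by move=> v1; rewrite insubdK //; apply/mem_set; have [] := chart_mapP v1. Qed.

(** The right side is closed, being cut out by the vanishing of coordinates. Conversely, each of its
    points is the image of some [v] in the closed ball, and the images of [(1 - t) *: v] with small
    positive [t] lie in the open cell. *)
Lemma closure_rocell : closure (rocell P) = [set x | supp (val x) \subset A].
Proof.
apply/seteqP; split=> x.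
  have cl : closed [set x : realization | supp (val x) \subset A].
    rewrite (_ : [set _ | _] = \bigcap_(a in [set a | a \notin A])
        (fun x : realization => val x 0 a) @^-1` [set 0 : R]); last first.
      apply/seteqP; split=> y /= H.
        move=> a /= aA; apply/eqP; apply: contraNT aA => ya.
        by apply: (fintype.subsetP H); rewrite inE.
      apply/fintype.subsetP => a; rewrite inE; apply: contra_neqT => aA.
      exact: (H a aA).
    apply: closed_bigI => a _; apply: closed_comp; last exact: closed_eq.
    move=> z _; apply: (@continuous_comp _ _ _ (@set_val _ realization) (fun u : 'rV_N => u 0 a)).
      exact: initial_continuous.
    exact: coord_continuous.
  move=> cx; rewrite ((closure_id _).1 cl); apply: closure_subset cx => y /= ->.
  exact: subxx.
move=> /= xA B nB.
have xr : realization (val x) by exact: set_valP.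
set v := chart_inv (val x).
have v1 : cball v by exact: chart_inv_ball.
have xv : cell_map v = x.
  by apply: val_inj; rewrite val_cell_map // chart_invK.
have cw : {within @cball R (rcdim P), continuous cell_map}.
  apply: within_continuous_insubd; first exact: continuous_chart_map.
  by move=> w /chart_mapP[].
have nvB : nbhs (cell_map v) B by rewrite xv.
move/subspace_continuousP: cw => /(_ v v1 B nvB).
rewrite /within /= => nv.
have lim : continuous (fun t : R => (1 - t) *: v).
  apply: continuous_row => j.
  rewrite (_ : (fun t => _) = (fun t => (1 - t) * v 0 j)); last first.
    by apply/funext => t; rewrite mxE.
  move=> t; apply: (@continuousM R R^o (fun t : R => 1 - t) (fun _ : R => v 0 j));
    last exact: cst_continuous.
  apply: (@continuousB R R^o R^o (fun=> 1) (fun t => t)); first exact: cst_continuous.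
  exact: cvg_id.
have := lim 0; rewrite /continuous_at subr0 scale1r => /(_ _ nv) /=.
rewrite /= -nbhs_ballE => -[e /= e0 He].
(* Less than [e] to land in the given neighbourhood, less than 1 to keep [1 - t] positive. *)
pose t := Num.min (e / 2) (1 / 2).
have t0 : 0 < t by rewrite lt_min !divr_gt0.
have te : t < e by rewrite gt_min; apply/orP; left; rewrite ltr_pdivrMr // mulr_natr mulr2n ltrDl.
have t1 : t < 1 by rewrite gt_min; apply/orP; right; rewrite ltr_pdivrMr // mul1r ltr1n.
have ob : oball ((1 - t) *: v).
  rewrite /oball /= -sqrt_norm2_lt1 -/(nrm _).
  have [_ _ nh _] := nrm_gauge.
  have t1' : 0 <= 1 - t by rewrite subr_ge0 ltW.
  rewrite nh //.
  have : nrm v <= 1 by rewrite sqrt_norm2_le1.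
  move=> nv1; rewrite (@le_lt_trans _ _ (1 - t)) //; last by rewrite ltrBlDr ltrDl.
  by rewrite ler_piMr.
have [cb sA] := (chart_map_open _).1 ob.
exists (cell_map ((1 - t) *: v)); split.
  by rewrite /rocell /= val_cell_map.
apply: He => //=.
by rewrite /ball /= sub0r normrN gtr0_norm.
Qed.

Lemma cell_map_char :
  [/\ homeo_between (@cball R (rcdim P)) (closure (rocell P)) cell_map,
      cell_map @` @oball R (rcdim P) = rocell P &
      cell_map @` @usphere R (rcdim P) `<=`
        [set x | exists2 Q, (rcdim Q < rcdim P)%N & rocell Q x]].
Proof.
have obc (v : 'rV[R]_(rcdim P)) : oball v -> cball v.
  by move=> ov; have [] := (chart_map_open v).1 ov.
have xr (x : realization) : realization (val x) by exact: set_valP.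
have mapK v : cball v -> chart_inv (val (cell_map v)) = v.
  by move=> v1; rewrite val_cell_map // chart_mapK.
have invK (x : realization) : supp (val x) \subset A -> cell_map (chart_inv (val x)) = x.
  move=> sx; apply: val_inj; rewrite val_cell_map ?chart_invK //.
  exact: chart_inv_ball.
split.
- exists (fun x => chart_inv (val x)); rewrite closure_rocell; split.
  + apply: within_continuous_insubd; first exact: continuous_chart_map.
    by move=> w /chart_mapP[].
  + apply: continuous_subspaceT => x.
    apply: (@continuous_comp _ _ _ (@set_val _ realization) chart_inv).
      exact: initial_continuous.
    exact: continuous_chart_inv.
  + apply/seteqP; split=> [_ [v v1 <-]|x /= sx] /=.
      by rewrite val_cell_map //; have [] := chart_mapP v1.
    by exists (chart_inv (val x)); [exact: (chart_inv_ball (xr x) sx) | exact: invK].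
  + apply/seteqP; split=> [_ [x /= sx <-]|v v1] /=.
      exact: (chart_inv_ball (xr x) sx).
    exists (cell_map v); last exact: mapK.
    by rewrite /= val_cell_map //; have [] := chart_mapP v1.
  + by split=> [v /set_mem/mapK|x /set_mem/invK].
- apply/seteqP; split=> [_ [v ov <-]|x /= sx].
    rewrite /rocell /= val_cell_map; last exact: obc.
    by case: ((chart_map_open v).1 ov) => _ ->.
  have sA : supp (val x) \subset A by rewrite sx.
  exists (chart_inv (val x)); last exact: invK.
  apply: (chart_map_open _).2; rewrite chart_invK //; split=> //.
  exact: (chart_inv_ball (xr x) sA).
- move=> _ [v v1 <-] /=.
  (* The image of a boundary point lies in the open cell of its own support. That support is a
     proper subset of [A], since full support would put [v] in the open ball, and so its cell has
     smaller dimension. *)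
  have cv : cball v by rewrite /cball /= v1.
  have [vr vA] := chart_mapP cv.
  have vv : valid r Phi (supp (chart_map v)) by case: vr.
  exists (Sub (supp (chart_map v)) vv); last by rewrite /rocell /= val_cell_map.
  rewrite -(ltn_add2r n) !card_nonpiv //=; last exact: valid_hits vv.
  apply: proper_card; rewrite properEneq vA andbT; apply/eqP => sA.
  have : oball v by apply: (chart_map_open _).2.
  by rewrite /oball /= v1 ltxx.
Qed.

End OneCell.

(** Closed with [Defined] so that cells and dimensions compute to [rcell] and [rcdim] later on. *)
Definition rainbowCW : regularCW R.
Proof.
refine (@RegularCW R realization rcell rcdim rocell _ _ _ _).
- exact: hausdorff_subtype.
- by move=> P Q x; rewrite /rocell /= => -> /val_inj.
- move=> x; have [_ _ vx] : realization (val x) by exact: set_valP.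
  by exists (Sub (supp (val x)) vx).
- by move=> P; exists (@cell_map P); exact: cell_map_char.
Defined.

Lemma faceE (Q P : cell rainbowCW) : face Q P <-> val Q \subset val P.
Proof.
rewrite /face [closure _]closure_rocell; split=> [|sQP x /= -> //].
(* The barycentre of [Q] has support exactly [val Q], so it alone tests the inclusion. *)
move=> /(_ (base_point Q)) /=; rewrite /rocell /= supp_centre; exact.
Qed.

End Realization.

(** * Linear strands *)

Section Strands.
Local Open Scope ring_scope.
Variables (k : fieldType) (N : nat).
Local Notation S := {mpoly k[N]}.
Implicit Types (F G L : gfree k N) (I : S -> Prop) (f g v : S) (u w m : 'X_{1..N}).

Lemma mcoeffMXm v w m : (v * 'X_[w])@_m = if (w <= m)%MM then v@_(m - w) else 0.
Proof.
case: ifP => [wm|/negP wm]; first by rewrite -{1}(submK wm) addmC mcoeffMX.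
rewrite {1}[v]mpolyE mulr_suml raddf_sum big1 //= => u _.
rewrite -scalerAl -mpolyXD mcoeffZ mcoeffX; case: eqP => [um|_]; last by rewrite mulr0.
by case: wm; rewrite -um lem_addl.
Qed.

Lemma mcoeffM_homog_lt e v g m : g \is e.-homog -> (mdeg m < e)%N -> (v * g)@_m = 0.
Proof.
move=> ge me; rewrite [g]mpolyE mulr_sumr raddf_sum big_seq big1 //= => w wg.
rewrite -scalerAr mcoeffZ mcoeffMXm; case: ifP => [wm|_]; last by rewrite mulr0.
have := mdegB m w; have := mdegD w (m - w)%MM; rewrite addmC submK //.
by rewrite (dhomog_mf ge wg) => dm; rewrite dm ltnNge leq_addr in me.
Qed.

(** A monomial of degree [e] in [v * g] can only come from the constant term of [v]. This is how
    coefficients over the ring are reduced to scalars below. *)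
Lemma mcoeffM_homog e v g m :
  g \is e.-homog -> mdeg m = e -> (v * g)@_m = v@_0%MM * g@_m.
Proof.
move=> ge me; rewrite [g in LHS]mpolyE mulr_sumr raddf_sum /=.
rewrite {3}[g]mpolyE raddf_sum mulr_sumr; apply: eq_big_seq => w wg /=.
rewrite -scalerAr !mcoeffZ mcoeffMXm mcoeffX mulrCA.
case: ifP => [wm|wm].
  have : mdeg m = (mdeg (m - w)%MM + mdeg w)%N by rewrite -mdegD submK.
  rewrite me (dhomog_mf ge wg) -[LHS]add0n => /addIn/esym/eqP.
  rewrite mdeg_eq0 => /eqP mw; rewrite mw.
  have -> : w = m by rewrite -(submK wm) mw add0m.
  by rewrite eqxx mulr1 mulrC.
case: eqP => [wm'|_]; last by rewrite !mulr0.
by rewrite wm' lepm_refl in wm.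
Qed.

Lemma homog_eq e f g : f \is e.-homog -> g \is e.-homog ->
  (forall m, mdeg m = e -> f@_m = g@_m) -> f = g.
Proof.
move=> fe ge fg; apply/mpolyP => m; have [/fg //|me] := eqVneq (mdeg m) e.
by rewrite (dhomog_nemf_coeff fe me) (dhomog_nemf_coeff ge me).
Qed.

Lemma homog_sum e (T : finType) (P : pred T) (f : T -> S) :
  (forall p, P p -> f p \is e.-homog) -> \sum_(p | P p) f p \is e.-homog.
Proof. by move=> H; apply: rpred_sum. Qed.

(** The augmentation plays the role of the differential out of homological degree 0. *)
Definition cyc L i : (bas L i -> S) -> Prop :=
  match i return (bas L i -> S) -> Prop with
  | 0 => fun z => \sum_q z q * aug q = 0
  | j.+1 => fun z => forall r : bas L j, \sum_q z q * dif q r = 0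
  end.

(* Characterises the linear strand: its generators are a k-basis of the degree n
   part of I, and its i.+1-st syzygies are a k-basis of the linear cycles. *)
Record strand I n L : Prop := Strand {
  strand_deg : forall i (p : bas L i), gdeg p = (n + i)%N;
  strand_lin : forall i (p : bas L i.+1) (q : bas L i), dif p q \is 1.-homog;
  strand_gen : forall p : bas L 0, I (aug p) /\ aug p \is n.-homog;
  strand_span : forall f, I f -> f \is n.-homog ->
    exists c : bas L 0 -> k, f = \sum_p c p *: aug p;
  strand_free : forall c : bas L 0 -> k,
    \sum_p c p *: aug p = 0 -> forall p, c p = 0;
  strand_cyc : forall i (p : bas L i.+1), cyc (dif p);
  strand_lift : forall i (z : bas L i -> S), (forall q, z q \is 1.-homog) ->
    cyc z -> exists c : bas L i.+1 -> k, forall q, z q = \sum_p c p *: dif p q;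
  strand_inj : forall i (c : bas L i.+1 -> k),
    (forall q, \sum_p c p *: dif p q = 0) -> forall p, c p = 0
}.

(** In a strand all generators of step [i] have degree [n + i], so degree-preserving maps between
    strands are matrices of scalars. *)
Definition chain_map L G (phi : forall i, bas L i -> bas G i -> k) : Prop :=
  (forall p : bas L 0, aug p = \sum_q phi 0%N p q *: aug q) /\
  (forall i (p : bas L i.+1) (q' : bas G i),
     \sum_q phi i q q' *: dif p q = \sum_p' phi i.+1 p p' *: dif p' q').

(** The comparison theorem restricted to linear parts: [strand_span] gives the map on generators,
    and [strand_lift] continues it one step at a time. *)
Lemma chain_map_ex I n L G : strand I n L -> strand I n G ->
  exists phi : forall i, bas L i -> bas G i -> k, chain_map phi.
Proof.
move=> SL SG.
pose push i (phi : bas L i -> bas G i -> k) (z : bas L i -> S) q' :=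
  \sum_q phi q q' *: z q.
(* The invariant carried along: cycles are pushed forward to cycles, which is what allows the next
   lift. *)
pose inv i phi := forall z, @cyc L i z -> @cyc G i (push i phi z).
have [phi0 Hphi0] : {phi0 : bas L 0 -> bas G 0 -> k &
    forall p, aug p = \sum_q phi0 p q *: aug q}.
  apply: (@choice _ _ (fun (p : bas L 0) (c : bas G 0 -> k) =>
    aug p = \sum_q c q *: aug q)) => p.
  by have [Ip hp] := strand_gen SL p; exact: strand_span SG _ Ip hp.
have inv0 : inv 0%N phi0.
  move=> z /= z0; rewrite -[RHS]z0 (eq_bigr (fun q => \sum_p (phi0 p q *: z p * aug q))).
    rewrite exchange_big /=; apply: eq_bigr => p _; rewrite Hphi0 mulr_sumr.
    by apply: eq_bigr => q _; rewrite -scalerAl -scalerAr.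
  by move=> q _; rewrite mulr_suml.
have step i (phi : bas L i -> bas G i -> k) : inv i phi ->
    exists phi' : bas L i.+1 -> bas G i.+1 -> k, inv i.+1 phi' /\
      forall p q', \sum_q phi q q' *: dif p q = \sum_p' phi' p p' *: dif p' q'.
  move=> iphi.
  have [phi' Hphi'] : {phi' : bas L i.+1 -> bas G i.+1 -> k &
      forall p q', \sum_q phi q q' *: dif p q = \sum_p' phi' p p' *: dif p' q'}.
    apply: (@choice _ _ (fun p c => forall q',
      \sum_q phi q q' *: dif p q = \sum_p' c p' *: dif p' q')) => p.
    apply: (strand_lift SG (z := push i phi (dif p))).
      by move=> q'; apply: homog_sum => q _; apply: dhomogZ; exact: (strand_lin SL).
    by apply: iphi; exact: (strand_cyc SL p).
  exists phi'; split=> // z /= zc r.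
  rewrite (eq_bigr (fun q => \sum_p (phi' p q *: z p * dif q r))); last first.
    by move=> q _; rewrite mulr_suml.
  rewrite exchange_big /= (eq_bigr (fun p => \sum_q (phi q r *: (z p * dif p q)))).
    rewrite exchange_big big1 //= => q _.
    by rewrite -scaler_sumr zc scaler0.
  move=> p _; rewrite (eq_bigr (fun q => z p * (phi' p q *: dif q r))).
    rewrite -mulr_sumr -Hphi' mulr_sumr.
    by apply: eq_bigr => q _; rewrite -scalerAr.
  by move=> q _; rewrite -scalerAl -scalerAr.
(* Each matrix depends on the preceding one, so the choices are made by recursion on matrices
   bundled with the invariant. *)
pose T i := {phi : bas L i -> bas G i -> k | inv i phi}.
have step' i (t : T i) : {t' : T i.+1 | forall p q',
    \sum_q sval t q q' *: dif p q = \sum_p' sval t' p p' *: dif p' q'}.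
  apply: cid; have [phi' [i' H']] := step i _ (svalP t).
  by exists (exist _ phi' i').
pose t := nat_rect T (exist _ phi0 inv0) (fun i t => sval (step' i t)).
exists (fun i => sval (t i)); split=> // i p q'.
exact: (svalP (step' i (t i))).
Qed.

Lemma chain_map_comp L G F (phi : forall i, bas L i -> bas G i -> k)
    (psi : forall i, bas G i -> bas F i -> k) :
  chain_map phi -> chain_map psi ->
  chain_map (fun i p s => \sum_q phi i p q * psi i q s).
Proof.
move=> [phi0 phiS] [psi0 psiS]; split=> [p|i p s].
  rewrite phi0 (eq_bigr (fun q => \sum_s (phi 0%N p q * psi 0%N q s) *: aug s)).
    by rewrite exchange_big; apply: eq_bigr => s _; rewrite scaler_suml.
  by move=> q _; rewrite psi0 scaler_sumr; apply: eq_bigr => s _; rewrite scalerA.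
transitivity (\sum_q psi i q s *: \sum_q0 phi i q0 q *: dif p q0).
  under eq_bigr do rewrite scaler_suml.
  rewrite exchange_big; apply: eq_bigr => q _; rewrite scaler_sumr.
  by apply: eq_bigr => q0 _; rewrite scalerA mulrC.
under eq_bigr do rewrite phiS.
transitivity (\sum_p' phi i.+1 p p' *: \sum_q psi i q s *: dif p' q).
  under eq_bigr do rewrite scaler_sumr.
  rewrite exchange_big; apply: eq_bigr => p' _; rewrite scaler_sumr.
  by apply: eq_bigr => q _; rewrite !scalerA mulrC.
under eq_bigr do rewrite psiS scaler_sumr.
rewrite exchange_big; apply: eq_bigr => p' _; rewrite scaler_suml.
by apply: eq_bigr => q _; rewrite scalerA.
Qed.

(** Rigidity: compatibility with the augmentation fixes step 0 because the generators are linearly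
    independent, and each later step is fixed by the one before through [strand_inj]. *)
Lemma chain_map_id I n L (th : forall i, bas L i -> bas L i -> k) :
  strand I n L -> chain_map th -> forall i p q, th i p q = (p == q)%:R.
Proof.
move=> SL [th0 thS].
have delta i (h : bas L i -> S) p : \sum_q (p == q)%:R *: h q = h p.
  rewrite (bigD1 p) //= eqxx scale1r big1 ?addr0 // => q.
  by rewrite eq_sym => /negPf->; rewrite scale0r.
elim=> [|i IH] p q; apply/eqP; rewrite -subr_eq0; apply/eqP.
  apply: (strand_free SL (c := fun q => th 0%N p q - (p == q)%:R)).
  under eq_bigr do rewrite scalerBl.
  by rewrite sumrB -th0 (delta 0%N) subrr.
apply: (strand_inj SL (c := fun q => th i.+1 p q - (p == q)%:R)) => s.
under eq_bigr do rewrite scalerBl.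
rewrite sumrB -thS (delta i.+1 (fun q => dif q s)).
under eq_bigr do rewrite IH eq_sym.
by rewrite (delta i (dif p)) subrr.
Qed.

(** Chain maps exist in both directions, and rigidity makes both composites the identity. *)
Lemma strand_iso I n L G : strand I n L -> strand I n G -> gfree_iso L G.
Proof.
move=> SL SG.
have [phi Hphi] := chain_map_ex SL SG; have [psi Hpsi] := chain_map_ex SG SL.
exists (fun i p q => (phi i p q)%:MP), (fun i p q => (psi i p q)%:MP); split.
- move=> i p q; right; rewrite (strand_deg SL) (strand_deg SG) leqnn subnn.
  by split=> //; rewrite -[_%:MP]mulr1 mul_mpolyC; apply: dhomogZ; exact: dhomog1.
- move=> i p p'; rewrite -mpolyC_nat -(chain_map_id SL (chain_map_comp Hphi Hpsi)).
  by rewrite raddf_sum; apply: eq_bigr => q _; rewrite -mpolyCM.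
- move=> i p p'; rewrite -mpolyC_nat -(chain_map_id SG (chain_map_comp Hpsi Hphi)).
  by rewrite raddf_sum; apply: eq_bigr => q _; rewrite -mpolyCM.
- move=> i p q'.
  under eq_bigr do rewrite mulrC mul_mpolyC.
  rewrite Hphi.2; apply: eq_bigr => p' _; rewrite mul_mpolyC.
  by [].
- by move=> p; rewrite Hphi.1; apply: eq_bigr => q _; rewrite mul_mpolyC.
Qed.

End Strands.

(** * The linear strand of a minimal resolution *)

Section StrandOfResolution.
Local Open Scope ring_scope.
Variables (k : fieldType) (N : nat).
Local Notation S := {mpoly k[N]}.
Variables (I : S -> Prop) (n : nat) (F : gfree k N).
Hypotheses (FI : minimal_graded_resolution I F) (In : initial_degree I n).

Let gF : graded F. Proof. by case: FI. Qed.
Let eF : exact_resolution I F. Proof. by case: FI. Qed.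
Let mF : minimal F. Proof. by case: FI. Qed.

Let delta i (p : bas F i) : {ffun bas F i -> S} := [ffun q => (q == p)%:R].

Let sum_delta_l i (p : bas F i) (h : bas F i -> S) : \sum_q delta p q * h q = h p.
Proof.
rewrite (bigD1 p) //= ffunE eqxx mul1r big1 ?addr0 // => q /negPf qp.
by rewrite ffunE qp mul0r.
Qed.

Let dmap_coef0 i (w : {ffun bas F i.+1 -> S}) q : (dmap w q)@_0%MM = 0.
Proof.
rewrite ffunE raddf_sum big1 //= => p _.
by rewrite rmorphM /= mF mulr0.
Qed.

(** By minimality every coefficient of a boundary has constant term 0, whereas a basis element has a
    coefficient 1. *)
Let delta_not_boundary i (p : bas F i) : ~ exists w, dmap w = delta p.
Proof.
case=> w /ffunP/(_ p) wp; have := dmap_coef0 w p.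
by rewrite wp ffunE eqxx mcoeff1 eqxx => /eqP; rewrite oner_eq0.
Qed.

(** A nonzero entry would have degree 0, and minimality excludes nonzero constants. *)
Let dif_eq0 i (p : bas F i.+1) (q : bas F i) : (gdeg p <= gdeg q)%N -> dif p q = 0.
Proof.
move=> pq; have [//|[qp]] := gF.1 _ p q.
have -> : (gdeg p - gdeg q = 0)%N by apply/eqP; rewrite subn_eq0.
move=> h0; apply: (homog_eq h0); first exact: dhomog0.
by move=> m /eqP; rewrite mdeg_eq0 => /eqP->; rewrite mF mcoeff0.
Qed.

Let aug_homog (p : bas F 0) : aug p \is (gdeg p).-homog.
Proof. by have [->|[_]] := gF.2 p; [exact: dhomog0 | rewrite subn0]. Qed.

Let dif_homog i (p : bas F i.+1) (q : bas F i) : dif p q \is (gdeg p - gdeg q).-homog.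
Proof. by have [->|[_]] := gF.1 _ p q; [exact: dhomog0 |]. Qed.

Let aug_in (p : bas F 0) : I (aug p).
Proof. by case: eF => H _ _; apply/H; exists (delta p); rewrite /augmap sum_delta_l. Qed.

(** Some entry [dif p q] is nonzero: otherwise [p] would be a cycle, hence a boundary, against
    minimality. By [dif_eq0] the degree then grows by at least 1 in each step. *)
Lemma leq_gdeg i (p : bas F i) : (n + i <= gdeg p)%N.
Proof.
case: eF => _ e0 eS; elim: i p => [|i IH] p.
  rewrite addn0; apply: (In.2 _ (aug p)) => //.
  apply/eqP => p0; apply: (@delta_not_boundary _ p); apply/e0.
  by rewrite /augmap sum_delta_l.
have [q pq] : exists q, dif p q != 0.
  apply/existsP; rewrite -negb_forall; apply/negP => /forallP H.
  apply: (@delta_not_boundary _ p); apply/eS; apply/ffunP => q.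
  by rewrite !ffunE sum_delta_l; exact/eqP.
rewrite addnS (leq_ltn_trans (IH q)) // ltnNge.
by apply: contra_neqN pq => /dif_eq0.
Qed.

Local Notation L := (linear_strand n F).

Let sum_on_strand (V : nmodType) i (h : bas F i -> V) :
  \sum_(q | gdeg q == (n + i)%N) h q = \sum_(q : bas L i) h (val q).
Proof.
rewrite (reindex_omap (val : bas L i -> bas F i) insub) => [|q qn]; last first.
  by rewrite insubT.
by apply: eq_bigl => q; rewrite (valP q) valK eqxx.
Qed.

Let sum_strand i (h : bas F i -> S) : (forall q, gdeg q != (n + i)%N -> h q = 0) ->
  \sum_q h q = \sum_(q : bas L i) h (val q).
Proof.
move=> h0; rewrite (bigID (fun q => gdeg q == (n + i)%N)) /= [X in _ + X]big1 // addr0.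
exact: sum_on_strand.
Qed.

Let ext i (z : bas L i -> S) : {ffun bas F i -> S} :=
  [ffun q => if insub q is Some q' then z q' else 0].

Let ext_val i (z : bas L i -> S) q : ext z (val q) = z q.
Proof. by rewrite ffunE valK. Qed.

Let ext_off i (z : bas L i -> S) q : gdeg q != (n + i)%N -> ext z q = 0.
Proof. by move=> qn; rewrite ffunE insubN. Qed.

Let sum_ext i (z : bas L i -> S) h : \sum_q ext z q * h q = \sum_q z q * h (val q).
Proof.
rewrite sum_strand => [|q qn]; last by rewrite ext_off // mul0r.
by apply: eq_bigr => q _; rewrite ext_val.
Qed.

Let gdeg_gt i (p : bas F i) : gdeg p != (n + i)%N -> (n + i < gdeg p)%N.
Proof. by move=> pn; rewrite ltn_neqAle eq_sym pn leq_gdeg. Qed.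

(** Generators off the strand have too high a degree to occur in the differential of a strand
    generator, so the strand is a subcomplex. *)
Let dif_off i (p : bas L i.+1) (q : bas F i) :
  gdeg q != (n + i)%N -> dif (val p) q = 0.
Proof. by move=> /gdeg_gt qn; apply: dif_eq0; rewrite (eqP (valP p)) addnS. Qed.

Let gdeg_strand i (p : bas L i) : gdeg (val p) = (n + i)%N.
Proof. exact: (eqP (valP p)). Qed.

Let dif_strand i (p : bas L i.+1) (q : bas L i) : dif (val p) (val q) \is 1.-homog.
Proof.
have pq : (gdeg (val p) - gdeg (val q) = 1)%N.
  by rewrite !gdeg_strand addnS subSnn.
by have := dif_homog (val p) (val q); rewrite pq.
Qed.

Let aug_strand (p : bas L 0) : aug (val p) \is n.-homog.
Proof.
have pn : gdeg (val p) = n by rewrite gdeg_strand addn0.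
by have := aug_homog (val p); rewrite pn.
Qed.

Lemma strand_linear_strand : strand I n L.
Proof.
case: (eF) => eI e0 eS; split.
- by move=> i p; exact: (eqP (valP p)).
- exact: dif_strand.
- by move=> p; split; [exact: aug_in | exact: aug_strand].
(* Generators of degree above [n] contribute nothing in degree [n], and those of degree [n]
   contribute only through the constant terms of their coefficients. *)
- move=> f /eI[v <-] fn; exists (fun p => (v (val p))@_0%MM).
  apply: (homog_eq fn) => [|m mn].
    by apply: homog_sum => p _; apply: dhomogZ; exact: aug_strand.
  rewrite /augmap !raddf_sum /=.
  rewrite (bigID (fun p : bas F 0 => gdeg p == (n + 0)%N)) /= [X in _ + X]big1; last first.
    move=> p /gdeg_gt pn; apply: (mcoeffM_homog_lt _ (aug_homog p)).
    by rewrite mn; move: pn; rewrite addn0.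
  rewrite addr0 sum_on_strand; apply: eq_bigr => p _.
  by rewrite mcoeffZ; apply: (mcoeffM_homog _ (aug_strand p)).
(* A scalar relation, extended by 0, is a cycle and so a boundary; by minimality its scalar
   coefficients vanish. *)
- move=> c c0 p.
  have : augmap (ext (fun q => (c q)%:MP)) = 0.
    by rewrite /augmap sum_ext -[RHS]c0; apply: eq_bigr => q _; rewrite mul_mpolyC.
  move/e0 => [w /ffunP/(_ (val p)) wp]; have := dmap_coef0 w (val p).
  by rewrite wp ext_val mcoeffC eqxx mulr1.
- have dd i (p : bas F i.+2) r : \sum_q dif p q * dif q r = 0.
    have : dmap (dmap (delta p)) = 0 by apply/eS; exists (delta p).
    move=> /ffunP/(_ r); rewrite !ffunE => Hr; rewrite -[RHS]Hr.
    by apply: eq_bigr => q _; rewrite ffunE sum_delta_l.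
  have da (p : bas F 1) : \sum_q dif p q * aug q = 0.
    have Hp : augmap (dmap (delta p)) = 0 by apply/e0; exists (delta p).
    by rewrite -[RHS]Hp; apply: eq_bigr => q _; rewrite ffunE sum_delta_l.
  case=> [|i] p /=.
    rewrite -[RHS](da (val p)) sum_strand // => q qn.
    by rewrite (dif_off (i := 0) p qn) mul0r.
  move=> r; rewrite -[RHS](dd _ (val p) (val r)) sum_strand // => q qn.
  by rewrite (dif_off p qn) mul0r.
(* Extended by 0, [z] is a cycle of [F], hence some [dmap w]. In degree 1 only strand generators are
   seen, through the constant terms of [w], because the others have entries of degree at least 2. *)
- move=> i z z1 zc.
  have [w wz] : exists w, dmap w = ext z.
    case: i z z1 zc => [|i] z z1 /= zc; first by apply/e0; rewrite /augmap sum_ext.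
    apply/eS/ffunP => r; rewrite !ffunE sum_ext.
    have [rn|rn] := boolP (gdeg r == (n + i)%N); first exact: (zc (Sub r rn)).
    by apply: big1 => q _; rewrite (dif_off q rn) mulr0.
  exists (fun p => (w (val p))@_0%MM) => q.
  apply: (homog_eq (z1 q)) => [|m m1].
    by apply: homog_sum => p _; apply: dhomogZ; exact: dif_strand.
  rewrite -ext_val -wz ffunE !raddf_sum /=.
  rewrite (bigID (fun p : bas F i.+1 => gdeg p == (n + i.+1)%N)) /= [X in _ + X]big1; last first.
    move=> p /gdeg_gt pn; apply: (mcoeffM_homog_lt _ (dif_homog p (val q))).
    by rewrite m1 gdeg_strand ltn_subRL; move: pn; rewrite addnS addn1.
  rewrite addr0 sum_on_strand; apply: eq_bigr => p _.
  by rewrite mcoeffZ; apply: (mcoeffM_homog _ (dif_strand p q)).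
- move=> i c c0 p.
  have : dmap (ext (fun p => (c p)%:MP)) = 0.
    apply/ffunP => q; rewrite !ffunE sum_ext.
    have [qn|qn] := boolP (gdeg q == (n + i)%N).
      rewrite -[RHS](c0 (Sub q qn)); apply: eq_bigr => s _.
      by rewrite mul_mpolyC.
    by apply: big1 => s _; rewrite (dif_off s qn) mulr0.
  move/eS => [w /ffunP/(_ (val p)) wp]; have := dmap_coef0 w (val p).
  by rewrite wp ext_val mcoeffC eqxx mulr1.
Qed.

End StrandOfResolution.

(** * Incidence signs *)

Section Signs.
Local Open Scope ring_scope.
Variables (N n : nat) (r : 'I_N -> 'I_n).
Implicit Types (A B E T : {set 'I_N}) (a b c d : 'I_N).

Lemma hitsD1 A a b : a \in A -> b \in A -> a != b -> r a = r b -> hits r A ->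
  hits r (A :\ a).
Proof.
move=> aA bA ab rab /hitsP hA; apply/hitsP => i; have [c cA <-] := hA i.
have [->|ca] := eqVneq c a; last by exists c; rewrite // !inE ca.
by exists b => //; rewrite !inE eq_sym ab.
Qed.

Lemma same_class_ex A : hits r A -> (n < #|A|)%N ->
  exists a b, [/\ a \in A, b \in A, a != b & r a = r b].
Proof.
move=> hA; rewrite -(card_nonpiv hA) -{1}[n]add0n ltn_add2r => /card_gt0P[a].
rewrite inE => /andP[aA pa]; have [pA rp _] := pivP r aA.
by exists a, (piv r A a); rewrite aA pA eq_sym pa rp.
Qed.

Lemma transversal_inj T : hits r T -> #|T| = n -> {in T &, injective r}.
Proof.
move=> /hitsP hT cT; apply/imset_injP.
have -> : r @: T = [set: 'I_n].
  by apply/setP => i; rewrite inE; have [a aT <-] := hT i; exact: imset_f.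
by rewrite cardsT card_ord cT.
Qed.

Lemma card_D1 A a m : a \in A -> #|A| = m.+1 -> #|A :\ a| = m.
Proof. by move=> aA; rewrite (cardsD1 a) aA add1n => -[]. Qed.

(** Some [c] other than [a] in [A] still hits the row of [a]. If [c] were not [b], then [a] and [c]
    would share a row in the transversal [A :\ b]. *)
Lemma pair_class A a b : #|A| = n.+1 -> a \in A -> b \in A -> a != b ->
  hits r (A :\ a) -> hits r (A :\ b) -> r a = r b.
Proof.
move=> cA aA bA ab ha hb; have /hitsP/(_ (r a))[c] := ha.
rewrite !inE => /andP[ca cA'] rc.
have [cb|cb] := eqVneq c b; first by rewrite -rc cb.
have := transversal_inj hb (card_D1 bA cA) _ _ rc.
by rewrite !inE cb cA' ab aA => /(_ isT isT) /eqP; rewrite (negPf ca).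
Qed.

(** An edge has only two vertices: deleting any third element would leave [a] and [b] in the same
    row of a transversal. *)
Lemma pair_only A a b c : #|A| = n.+1 -> a \in A -> b \in A -> a != b -> r a = r b ->
  c \in A -> hits r (A :\ c) -> c = a \/ c = b.
Proof.
move=> cA aA bA ab rab cA' hc.
have [->|ca] := eqVneq c a; first by left.
have [->|cb] := eqVneq c b; first by right.
have := transversal_inj hc (card_D1 cA' cA) _ _ rab.
by rewrite !inE eq_sym ca aA eq_sym cb bA => /(_ isT isT)/eqP; rewrite (negPf ab).
Qed.

(* Ordering by colour first makes two elements of one colour adjacent in a set
   having one element of every other colour, so that the two vertices of an edge
   get opposite signs. *)
Definition prec a b : bool := (r a < r b)%N || ((r a == r b) && (a < b)%N).

Definition below A a : {set 'I_N} := [set b in A | prec b a].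

Definition sgn A a : int := (-1) ^+ #|below A a|.

Lemma prec_irr a : prec a a = false.
Proof. by rewrite /prec !ltnn andbF. Qed.

Lemma prec_asym a b : prec a b -> prec b a = false.
Proof.
by rewrite /prec -!val_eqE /=; move: (nat_of_ord (r a)) (nat_of_ord (r b)) => x y; lia.
Qed.

Lemma prec_total a b : a != b -> prec a b || prec b a.
Proof.
rewrite /prec -!val_eqE /=.
by move: (nat_of_ord (r a)) (nat_of_ord (r b)) => x y; lia.
Qed.

Lemma prec_trans b a c : prec a b -> prec b c -> prec a c.
Proof.
rewrite /prec -!val_eqE /=.
by move: (nat_of_ord (r a)) (nat_of_ord (r b)) (nat_of_ord (r c)) => x y z; lia.
Qed.

Lemma prec_between a b c : prec a b -> prec b c -> r a = r c -> r b = r a.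
Proof.
move=> ab bc ac; apply/val_inj; move: ab bc; rewrite /prec ac -!val_eqE /=.
by move: (nat_of_ord (r b)) (nat_of_ord (r c)) => x y; lia.
Qed.

Lemma sgn_sqr A a : sgn A a * sgn A a = 1.
Proof. by rewrite /sgn -expr2 sqrr_sign. Qed.

(** Deleting the smaller of the two elements flips the sign of the larger one; deleting the larger
    does not affect the smaller. *)
Lemma sgn_swap A a b : a \in A -> b \in A -> a != b ->
  sgn A a * sgn (A :\ a) b = - (sgn A b * sgn (A :\ b) a).
Proof.
wlog ab : a b / prec a b => [H aA bA ab|aA bA _].
  have /orP[pab|pba] := prec_total ab; first exact: H.
  by apply: oppr_inj; rewrite opprK; apply/esym/H => //; rewrite eq_sym.
have -> : sgn (A :\ b) a = sgn A a.
  congr (_ ^+ _); apply: eq_card => c; rewrite !inE.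
  by have [->|//] := eqVneq c b; rewrite (prec_asym ab) !andbF.
have -> : sgn A b = - sgn (A :\ a) b; last by rewrite mulNr opprK mulrC.
rewrite /sgn (cardsD1 a) inE aA ab add1n exprS mulN1r; congr (- (_ ^+ _)).
by apply: eq_card => c; rewrite !inE andbA.
Qed.

Lemma sgn_pair A a b : #|A| = n.+1 -> a \in A -> b \in A -> a != b ->
  hits r (A :\ a) -> hits r (A :\ b) -> sgn A a + sgn A b = 0.
Proof.
wlog ab : a b / prec a b => [H cA aA bA ab ha hb|cA aA bA nab ha hb].
  have /orP[pab|pba] := prec_total ab; first exact: H.
  by rewrite addrC; apply: H => //; rewrite eq_sym.
have rab := pair_class cA aA bA nab ha hb.
have -> : sgn A b = - sgn A a; last by rewrite subrr.
rewrite /sgn (cardsD1 a) inE aA ab add1n exprS mulN1r; congr (- (_ ^+ _)).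
apply: eq_card => c; rewrite !inE.
have [->|ca] /= := eqVneq c a; first by rewrite prec_irr andbF.
case: (boolP (c \in A)) => //= cA'; apply/idP/idP => [cb|/prec_trans]; last exact.
have [//|ac] := boolP (prec c a); have /orP[ac'|] := prec_total ca.
  by rewrite ac' in ac.
(* An element strictly between [a] and [b] would lie in their row and share it with [a] in the
   transversal [A :\ b]. *)
move=> ac'; have rc := prec_between ac' cb rab.
have cb' : c != b by apply: contraTneq cb => ->; rewrite prec_irr.
have := transversal_inj hb (card_D1 bA cA) _ _ rc.
by rewrite !inE cb' cA' nab aA => /(_ isT isT)/eqP; rewrite (negPf ca).
Qed.

(** At most one [a] contributes, so the value is a sign or 0. *)
Definition incid B A : int := \sum_(a in A | A :\ a == B) sgn A a.

Lemma setD1_inj A a b : a \in A -> b \in A -> A :\ a = A :\ b -> a = b.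
Proof.
move=> aA bA /setP/(_ a); rewrite !inE eqxx aA andbT /=.
by case: eqP.
Qed.

Lemma incid_D1 A a : a \in A -> incid (A :\ a) A = sgn A a.
Proof.
move=> aA; rewrite /incid (bigD1 a) ?aA ?eqxx //= big1 ?addr0 // => b.
by case/andP=> /andP[bA /eqP/setD1_inj ->]; rewrite ?eqxx.
Qed.

Lemma incid_neq0 B A : incid B A != 0 -> exists2 a, a \in A & B = A :\ a.
Proof.
have [/exists_inP[a aA /eqP <-] _|/exists_inPn H] :=
  boolP [exists a in A, A :\ a == B]; first by exists a.
by rewrite /incid big1 ?eqxx // => a /andP[aA aB]; have := H a aA; rewrite aB.
Qed.

Lemma incid_val B A : incid B A \in [:: 0; 1; -1].
Proof.
have [->|/incid_neq0[a aA ->]] := eqVneq (incid B A) 0; first by rewrite !inE eqxx.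
by rewrite incid_D1 // /sgn -signr_odd; case: odd.
Qed.

Variables (R : realType) (Phi : {set {set 'I_N}}).
Local Notation X := (rainbowCW R r Phi).

Definition cell_incid (Q P : cell X) : int := incid (val Q) (val P).

Lemma cdim_card (P : cell X) : (cdim P + n)%N = #|val P|.
Proof. exact: card_nonpiv (valid_hits (valP P)). Qed.

Lemma codim1_faceE (Q P : cell X) :
  codim1_face Q P <-> exists2 a, a \in val P & val Q = val P :\ a.
Proof.
rewrite /codim1_face faceE; split=> [[sQP dim]|[a aP QP]].
  have cPQ : #|val P| = #|val Q|.+1 by rewrite -!cdim_card dim addSn.
  have /card_gt0P[a] : (0 < #|val P :\: val Q|)%N.
    by rewrite cardsD (setIidPr sQP) cPQ subSnn.
  rewrite inE => /andP[aQ aP]; exists a => //; apply/eqP.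
  rewrite eqEcard (card_D1 aP cPQ) leqnn andbT subsetD1 sQP.
  exact: aQ.
split; first by rewrite QP subD1set.
apply: (can_inj (addnK n)); rewrite addSn !cdim_card QP (cardsD1 a (val P)).
by rewrite aP.
Qed.

Lemma incidence_cell_incid : incidence cell_incid.
Proof.
split.
- by move=> Q P; exact: incid_val.
- move=> Q P; rewrite codim1_faceE; split=> [/incid_neq0 //|[a aP QP]].
  by rewrite /cell_incid QP incid_D1 // signr_eq0.
- move=> E Q1 Q2 P Q12 /codim1_faceE[c cQ1 E1] /codim1_faceE[c' cQ2 E2].
  move=> /codim1_faceE[a aP eQ1] /codim1_faceE[b bP eQ2].
  have ab : a != b by apply: contra_not_neq Q12 => ab; apply/val_inj; rewrite eQ1 eQ2 ab.
  (* [E] arises from [P] by deleting [a] and [b], in one order through [Q1] and in the other through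
     [Q2]. *)
  have cb : c = b.
    apply/eqP; apply: contraTT isT => cb.
    have : b \in val E by rewrite E1 !inE eq_sym cb eQ1 !inE eq_sym ab.
    by rewrite E2 eQ2 !inE eqxx andbF.
  have c'a : c' = a.
    apply/eqP; apply: contraTT isT => ca.
    have : a \in val E by rewrite E2 !inE eq_sym ca eQ2 !inE ab.
    by rewrite E1 eQ1 !inE eqxx andbF.
  rewrite /cell_incid {1}E1 E2 eQ1 eQ2 cb c'a !incid_D1 //.
  + by rewrite sgn_swap // addNr.
  + by rewrite !inE ab.
  + by rewrite !inE eq_sym ab.
- move=> v w P vw v0 w0 /codim1_faceE[a aP ev] /codim1_faceE[b bP ew].
  have ab : a != b by apply: contra_not_neq vw => ab; apply/val_inj; rewrite ev ew ab.
  rewrite /cell_incid ev ew !incid_D1 //; apply: sgn_pair => //.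
  + by have := cdim_card v; rewrite v0 ev (cardsD1 a (val P)) aP => <-.
  + by rewrite -ev; exact: valid_hits (valP v).
  + by rewrite -ew; exact: valid_hits (valP w).
Qed.

End Signs.

(** * The cellular complex *)

Section CellularStrand.
Local Open Scope ring_scope.
Variables (k : fieldType) (N n : nat) (r : 'I_N -> 'I_n).
Variables (R : realType) (Phi : {set {set 'I_N}}).
Local Notation S := {mpoly k[N]}.
Local Notation X := (rainbowCW R r Phi).
Implicit Types (A B E T : {set 'I_N}) (a b c d : 'I_N).

(** Take [a] in its own row and the pivot in every other row. *)
Lemma transversal_through A a : hits r A -> a \in A ->
  exists T : {set 'I_N}, [/\ hits r T, #|T| = n, T \subset A & a \in T].
Proof.
move=> hA aA; pose T := [set b in A | b == if r b == r a then a else piv r A b].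
have aT : a \in T by rewrite inE aA !eqxx.
have hT : hits r T.
  apply/hitsP => i; have /hitsP/(_ i)[b bA <-] := hA.
  have [rb|rb] := eqVneq (r b) (r a); first by exists a.
  have [pA rp _] := pivP r bA; exists (piv r A b) => //.
  by rewrite inE pA rp (negPf rb) piv_piv // eqxx.
exists T; split=> //; last by apply/fintype.subsetP => b; rewrite inE => /andP[].
have <- : #|r @: T| = #|T|.
  apply: card_in_imset => b c; rewrite !inE => /andP[bA /eqP eb] /andP[cA /eqP ec] rbc.
  rewrite eb ec rbc; case: ifP => // _; exact: eq_piv.
rewrite -[RHS](card_ord n) -cardsT; congr #|pred_of_set _|.
by apply/setP => i; rewrite inE; have /hitsP/(_ i)[b bT <-] := hT; exact: imset_f.
Qed.

Definition ind A : 'X_{1..N} := [multinom (a \in A : nat) | a < N].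

Lemma indE A a : ind A a = (a \in A).
Proof. exact: mnmE. Qed.

Lemma ind_inj : injective ind.
Proof.
move=> A B AB; apply/setP => a; have /(congr1 (fun m : 'X_{1..N} => m a)) := AB.
by rewrite !indE; case: (a \in A); case: (a \in B).
Qed.

Lemma mdeg_ind A : mdeg (ind A) = #|A|.
Proof.
rewrite mdegE -sum1_card [RHS]big_mkcond; apply: eq_bigr => a _.
by rewrite indE; case: (a \in A).
Qed.

Lemma ind_D1 A a : a \in A -> (ind (A :\ a) + U_(a))%MM = ind A.
Proof.
move=> aA; apply/mnmP => b; rewrite mnmDE !indE mnm1E !inE eq_sym.
by have [<-|ba] := eqVneq a b; rewrite ?aA ?addn0.
Qed.

Definition cell_lab (P : cell X) : 'X_{1..N} := ind (val P).

(** Every variable of a cell lies on one of its vertices by [transversal_through], so the lcm of the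
    vertex monomials is the squarefree monomial of the cell. *)
Lemma label_cell_lab (P : cell X) : label cell_lab P = ind (val P).
Proof.
apply/mnmP => a; rewrite indE /label.
rewrite (@big_morph _ _ (fun m : 'X_{1..N} => m a) 0%N maxn _ (@mlcm N)); last 2 first.
- by move=> u w; rewrite mnmE.
- exact: mnm0E.
apply/anti_leq/andP; split.
  apply/bigmax_leqP => v /andP[_ /asboolP/faceE/fintype.subsetP sv].
  by rewrite /cell_lab indE; case: (boolP (a \in val v)) => // /sv ->.
case: (boolP (a \in val P)) => // aP.
have [T [hT cT sT aT]] := transversal_through (valid_hits (valP P)) aP.
have vT : valid r Phi T by exact: validS sT hT (valP P).
pose v : cell X := Sub T vT.
apply: (@leq_trans (cell_lab v a)); first by rewrite /cell_lab indE /= aT.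
apply: (@leq_bigmax_cond _ _ (fun v : cell X => cell_lab v a)).
apply/andP; split; last by apply/asboolP/faceE.
by rewrite -(eqn_add2r n) (cdim_card v) /= cT.
Qed.

Definition sg A a : k := (sgn r A a)%:~R.

Lemma sg_sqr A a : sg A a * sg A a = 1.
Proof. by rewrite /sg -intrM sgn_sqr. Qed.

Lemma sg_neq0 A a : sg A a != 0.
Proof. by have := oner_eq0 k; rewrite -(sg_sqr A a) mulf_eq0 orbb => ->. Qed.

(** The entries of the cellular differential, extended to all pairs of sets so that deletions can be
    handled without checking that they are cells. *)
Definition sdif A B : S := \sum_(a in A | A :\ a == B) sg A a *: 'X_a.

Lemma sdif_D1 A a : a \in A -> sdif A (A :\ a) = sg A a *: 'X_a.
Proof.
move=> aA; rewrite /sdif (bigD1 a) ?aA ?eqxx //= big1 ?addr0 // => b.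
by case/andP=> /andP[bA /eqP/setD1_inj ->]; rewrite ?eqxx.
Qed.

Lemma sdif_neq0 A B : sdif A B != 0 -> exists2 a, a \in A & B = A :\ a.
Proof.
have [/exists_inP[a aA /eqP <-] _|/exists_inPn H] :=
  boolP [exists a in A, A :\ a == B]; first by exists a.
by rewrite /sdif big1 ?eqxx // => a /andP[aA aB]; have := H a aA; rewrite aB.
Qed.

Lemma sdif_homog A B : sdif A B \is 1.-homog.
Proof. by apply: homog_sum => a _; apply: dhomogZ; rewrite dhomogX; apply/eqP; exact: mdeg1. Qed.

Local Notation C := (cellular k (@cell_incid N n r R Phi) cell_lab).

Definition cset i (P : bas C i) : {set 'I_N} := val (val P).

Lemma cset_inj i : injective (@cset i).
Proof. by move=> P Q /val_inj/val_inj. Qed.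

Lemma card_cset i (P : bas C i) : #|cset P| = (n + i)%N.
Proof. by rewrite -cdim_card (eqP (valP P)) addnC. Qed.

Lemma valid_cset i (P : bas C i) : valid r Phi (cset P).
Proof. exact: valP (val P). Qed.

Lemma cset_ex i A : valid r Phi A -> #|A| = (n + i)%N -> exists P : bas C i, cset P = A.
Proof.
move=> vA cA; pose Q : cell X := Sub A vA.
have Qi : cdim Q == i by rewrite -(eqn_add2r n) (cdim_card Q) /= cA addnC.
by exists (Sub Q Qi).
Qed.

Lemma cellular_difE i (P : bas C i.+1) (Q : bas C i) : dif P Q = sdif (cset P) (cset Q).
Proof.
rewrite /= !label_cell_lab /cell_incid -/(cset P) -/(cset Q).
have [H|/sdif_neq0[a aP QP]] := eqVneq (sdif (cset P) (cset Q)) 0.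
  rewrite H; have [->|/incid_neq0[a aP QP]] := eqVneq (incid r (cset Q) (cset P)) 0.
    by rewrite mul0r.
  move: H; rewrite QP sdif_D1 // => /(congr1 (fun p : S => p@_U_(a)%MM)).
  rewrite mcoeffZ mcoeffX eqxx mulr1 mcoeff0 => /eqP.
  by rewrite (negPf (sg_neq0 _ _)).
rewrite QP sdif_D1 // incid_D1 // -{1}(ind_D1 aP) addmC addmK.
by rewrite -mul_mpolyC /sg rmorph_int.
Qed.

Lemma cellular_augE (P : bas C 0) : aug P = 'X_[ind (cset P)] :> S.
Proof. by rewrite /= label_cell_lab. Qed.

Lemma cellular_deg i (P : bas C i) : gdeg P = (n + i)%N.
Proof. by rewrite /= label_cell_lab mdeg_ind card_cset. Qed.

(** Choose [a] in [P] so that [Q = P :\ a] is a face. The pair of [Q] and the variable [a]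
    determines [P], so the coefficient of that variable at [Q] isolates [c P] up to sign. *)
Lemma cellular_inj i (c : bas C i.+1 -> k) :
  (forall Q, \sum_P c P *: dif P Q = 0) -> forall P, c P = 0.
Proof.
move=> H P; have hP := valid_hits (valid_cset P).
have [a [b [aP bP ab rab]]] : exists a b, [/\ a \in cset P, b \in cset P, a != b & r a = r b].
  by apply: same_class_ex => //; rewrite card_cset addnS ltnS leq_addr.
have hPa := hitsD1 aP bP ab rab hP.
have cPa : #|cset P :\ a| = (n + i)%N by apply: card_D1 => //; rewrite card_cset addnS.
have [Q QP] := cset_ex (validS (subD1set _ _) hPa (valid_cset P)) cPa.
have : \sum_P' c P' *: sdif (cset P') (cset Q) = 0.
  by rewrite -[RHS](H Q); apply: eq_bigr => P' _; rewrite -cellular_difE.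
move/(congr1 (fun p : S => p@_U_(a)%MM)).
rewrite mcoeff0 raddf_sum /= (bigD1 P) //= QP sdif_D1 // big1 => [|P' P'P].
  rewrite addr0 !mcoeffZ mcoeffX eqxx mulr1 => /eqP.
  by rewrite mulf_eq0 (negPf (sg_neq0 _ _)) orbF => /eqP.
rewrite mcoeffZ; have [->|/sdif_neq0[d dP' e]] := eqVneq (sdif (cset P') (cset P :\ a)) 0.
  by rewrite mcoeff0 mulr0.
rewrite e sdif_D1 // mcoeffZ mcoeffX; case: eqP => [/mnmP/(_ d)|_]; last by rewrite !mulr0.
rewrite !mnm1E eqxx; case: eqP => // ad _.
case/eqP: P'P; apply: cset_inj; rewrite -(setD1K dP') -(setD1K aP) -e.
by rewrite ad.
Qed.

Lemma cellular_cyc i (P : bas C i.+1) : cyc (dif P).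
Proof.
have hP := valid_hits (valid_cset P); have vP := valid_cset P; have cP := card_cset P.
case: i P hP vP cP => [|i] P hP vP cP /=.
  rewrite addn1 in cP.
  have [a [b [aP bP ab rab]]] : exists a b, [/\ a \in cset P, b \in cset P, a != b & r a = r b].
    by apply: same_class_ex; rewrite ?cP.
  have ha := hitsD1 aP bP ab rab hP.
  have hb : hits r (cset P :\ b) by apply: hitsD1 bP aP _ _ hP; rewrite // eq_sym.
  have [Qa ea] : exists Q : bas C 0, cset Q = cset P :\ a.
    apply: cset_ex; first exact: validS (subD1set _ _) ha vP.
    by rewrite addn0; exact: card_D1.
  have [Qb eb] : exists Q : bas C 0, cset Q = cset P :\ b.
    apply: cset_ex; first exact: validS (subD1set _ _) hb vP.
    by rewrite addn0; exact: card_D1.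
  have Qab : Qb != Qa.
    apply: contra_neqN ab => // /eqP e; apply/(setD1_inj aP bP).
    by rewrite -ea -eb e.
  transitivity (\sum_(Q : bas C 0) sdif (cset P) (cset Q) * 'X_[ind (cset Q)]).
    by apply: eq_bigr => Q _; rewrite -cellular_difE -cellular_augE.
  (* An edge has exactly the vertices [Qa] and [Qb]. Both products equal the monomial of the edge,
     and the signs are opposite. *)
  rewrite (bigD1 Qa) // (bigD1 Qb) //= big1 ?addr0 => [|Q /andP[QQa QQb]].
    rewrite ea eb !sdif_D1 // -!scalerAl -!mpolyXD ![(U_(_) + _)%MM]addmC !ind_D1 //.
    by rewrite -scalerDl /sg -intrD sgn_pair // scale0r.
  have [->|/sdif_neq0[c cP' Qc]] := eqVneq (sdif (cset P) (cset Q)) 0; first by rewrite mul0r.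
  have hc : hits r (cset P :\ c) by rewrite -Qc; exact: valid_hits (valid_cset Q).
  have [ca|cb] := pair_only cP aP bP ab rab cP' hc.
    by case/eqP: QQa; apply: cset_inj; rewrite ea Qc ca.
  by case/eqP: QQb; apply: cset_inj; rewrite eb Qc cb.
move=> E.
transitivity (\sum_(Q : bas C i.+1) sdif (cset P) (cset Q) * sdif (cset Q) (cset E)).
  by apply: eq_bigr => Q _; rewrite -!cellular_difE.
have [/existsP[Qa]|/existsPn H] :=
  boolP [exists Q : bas C i.+1, sdif (cset P) (cset Q) * sdif (cset Q) (cset E) != 0]; last first.
  by apply: big1 => Q _; apply/eqP; have := H Q; rewrite negbK.
rewrite mulf_eq0 negb_or => /andP[/sdif_neq0[a aP ea] /sdif_neq0[b]].
rewrite ea !inE => /andP[ba bP] eE; rewrite eq_sym in ba.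
have eE' : cset E = cset P :\ b :\ a by rewrite eE !setDDl setUC.
(* The other intermediate set [P :\ b] contains the cell [E], hence meets every row, and as a subset
   of [P] it is a cell too. *)
have hb : hits r (cset P :\ b).
  by apply: hitsS (valid_hits (valid_cset E)); rewrite eE' subD1set.
have [Qb eb] : exists Q : bas C i.+1, cset Q = cset P :\ b.
  apply: cset_ex; first exact: validS (subD1set _ _) hb vP.
  by apply: card_D1 => //; rewrite cP addnS.
have Qab : Qb != Qa.
  apply: contra_neqN ba => // /eqP e; apply/(setD1_inj aP bP).
  by rewrite -ea -eb e.
rewrite (bigD1 Qa) // (bigD1 Qb) //= big1 ?addr0 => [|Q /andP[QQa QQb]].
  rewrite {1}eE eE' ea eb !sdif_D1 ?inE ?aP ?bP ?ba 1?eq_sym ?ba //.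
  rewrite -!scalerAl -!scalerAr !scalerA [X in _ + _ *: X]mulrC -scalerDl.
  by rewrite /sg -!intrM -intrD sgn_swap // addNr scale0r.
have [->|/sdif_neq0[c cP' Qc]] := eqVneq (sdif (cset P) (cset Q)) 0; first by rewrite mul0r.
have [->|/sdif_neq0[d dQ Ed]] := eqVneq (sdif (cset Q) (cset E)) 0; first by rewrite mulr0.
have : c \notin cset E by rewrite Ed Qc !inE eqxx andbF.
rewrite eE !inE cP' andbT negb_and !negbK => /orP[/eqP cb|/eqP ca].
  by case/eqP: QQb; apply: cset_inj; rewrite eb Qc cb.
by case/eqP: QQa; apply: cset_inj; rewrite ea Qc ca.
Qed.

Lemma sdif_coef A B b :
  (sdif A B)@_U_(b)%MM = if (b \in A) && (A :\ b == B) then sg A b else 0.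
Proof.
rewrite raddf_sum /=.
rewrite (eq_bigr (fun a => sg A a * (a == b)%:R)) => [|a _]; last first.
  by rewrite mcoeffZ mcoeffXU.
case: ifP => [/andP[bA bB]|nb].
  rewrite (bigD1 b) ?bA //= eqxx mulr1 big1 ?addr0 // => a /andP[_ /negPf->].
  by rewrite mulr0.
apply: big1 => a /andP[aA aB]; case: eqP => [ab|_]; last by rewrite mulr0.
by rewrite -ab aA aB in nb.
Qed.

Lemma mcoeffMX_UU (p : S) a b c : b != c ->
  (p * 'X_a)@_(U_(b) + U_(c))%MM =
  (a == b)%:R * p@_U_(c)%MM + (a == c)%:R * p@_U_(b)%MM.
Proof.
move=> bc; have [->|ab] := eqVneq a b.
  by rewrite mcoeffMX (negPf bc) mul1r mul0r addr0.
have [->|ac] := eqVneq a c; first by rewrite addmC mcoeffMX mul1r mul0r add0r.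
rewrite !mul0r addr0 mcoeffMXm; case: mnm_lepP => // /(_ a).
by rewrite mnmDE !mnm1E eqxx eq_sym (negPf ab) eq_sym (negPf ac).
Qed.

Lemma mcoeffMX_U2 (p : S) a b :
  (p * 'X_a)@_(U_(b) + U_(b))%MM = (a == b)%:R * p@_U_(b)%MM.
Proof.
have [->|ab] := eqVneq a b; first by rewrite mcoeffMX mul1r.
rewrite !mul0r mcoeffMXm; case: mnm_lepP => // /(_ a).
by rewrite mnmDE !mnm1E eqxx eq_sym (negPf ab).
Qed.

(** * Lifting linear cycles *)

Section Lift.
Variables (i : nat) (z : bas C i -> S).
Hypothesis z1 : forall Q, z Q \is 1.-homog.

(** [z] extended by 0 to all sets; at most one cell contributes to the sum. *)
Definition cycle_at B : S := \sum_(Q | cset Q == B) z Q.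

Definition cycle_coef B b : k := (cycle_at B)@_U_(b)%MM.

Local Notation Z := cycle_at.
Local Notation lam := cycle_coef.

Lemma cycle_at_cset Q : Z (cset Q) = z Q.
Proof.
have e Q' : (cset Q' == cset Q) = (Q' == Q) by apply/eqP/eqP => [/cset_inj|->].
by rewrite /cycle_at (eq_bigl _ _ e) big_pred1_eq.
Qed.

Lemma cycle_at_eq0 B : ~~ (valid r Phi B && (#|B| == n + i)%N) -> Z B = 0.
Proof.
move=> nB; apply: big1 => Q /eqP QB; case/negP: nB.
by rewrite -QB valid_cset card_cset eqxx.
Qed.

Lemma cycle_coef_neq0 B b : lam B b != 0 -> valid r Phi B /\ #|B| = (n + i)%N.
Proof.
have [/andP[vB /eqP cB]//|nB] := boolP (valid r Phi B && (#|B| == n + i)%N).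
by rewrite /cycle_coef cycle_at_eq0 // mcoeff0 eqxx.
Qed.

Lemma sum_cycle_at (h : {set 'I_N} -> S) : \sum_Q z Q * h (cset Q) = \sum_B Z B * h B.
Proof.
rewrite (partition_big (@cset i) xpredT) //=; apply: eq_bigr => B _.
by rewrite mulr_suml; apply: eq_bigr => Q /eqP->.
Qed.

(** The coefficient at a cell [P] is forced by the variable [a] at any face [P :\ a], up to a sign
    that squares to 1. [h3] makes it independent of [a]; [h1] and [h2] say that [z] has no terms
    other than those that such cells produce. *)
Lemma lift_from
    (h1 : forall B b, b \in B -> lam B b = 0)
    (h2 : forall B a, a \notin B -> lam B a != 0 -> valid r Phi (a |: B))
    (h3 : forall A a c, #|A| = (n + i).+1 -> a \in A -> c \in A -> a != c ->
       valid r Phi A -> hits r (A :\ a) -> hits r (A :\ c) ->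
       sg A a * lam (A :\ a) a = sg A c * lam (A :\ c) c) :
  exists c : bas C i.+1 -> k, forall Q, z Q = \sum_P c P *: dif P Q.
Proof.
pose c (P : bas C i.+1) : k :=
  if [pick a in cset P | hits r (cset P :\ a)] is Some a
  then sg (cset P) a * lam (cset P :\ a) a else 0.
have cE P a : a \in cset P -> hits r (cset P :\ a) ->
    c P = sg (cset P) a * lam (cset P :\ a) a.
  move=> aP ha; rewrite /c; case: pickP => [b /andP[bP hb]|/(_ a)]; last by rewrite aP ha.
  have [->//|ba] := eqVneq b a; apply: h3 => //; last exact: valid_cset.
  by rewrite card_cset addnS.
exists c => Q.
have -> : \sum_P c P *: dif P Q = \sum_P c P *: sdif (cset P) (cset Q).
  by apply: eq_bigr => P _; rewrite -cellular_difE.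
apply: (homog_eq (z1 Q)) => [|m /eqP/mdeg1P[b /eqP ->]].
  by apply: homog_sum => P _; apply: dhomogZ; exact: sdif_homog.
rewrite -cycle_at_cset -/(cycle_coef _ _) raddf_sum /=.
under eq_bigr do rewrite mcoeffZ sdif_coef.
have off P : ~~ ((b \in cset P) && (cset P :\ b == cset Q)) ->
    c P * (if (b \in cset P) && (cset P :\ b == cset Q) then sg (cset P) b else 0) = 0.
  by move=> /negPf->; rewrite mulr0.
have [bQ|bQ] := boolP (b \in cset Q).
  rewrite h1 // big1 // => P _; apply: off; rewrite negb_and orbC.
  by apply/orP; left; apply: contraTneq bQ => <-; rewrite !inE eqxx.
have [vA|nA] := boolP (valid r Phi (b |: cset Q)); last first.
  rewrite big1 => [|P _]; first by apply/eqP; apply: contraNT nA; exact: h2.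
  apply: off; apply: contra nA => /andP[bP /eqP<-].
  by rewrite setD1K // valid_cset.
have [P PA] : exists P : bas C i.+1, cset P = b |: cset Q.
  by apply: cset_ex => //; rewrite cardsU1 bQ card_cset addnS.
have bP : b \in cset P by rewrite PA setU11.
have PbQ : cset P :\ b = cset Q by rewrite PA setU1K.
rewrite (bigD1 P) //= big1 ?addr0 => [|P' P'P]; last first.
  apply: off; apply: contraNN P'P => /andP[bP' /eqP P'Q].
  by apply/eqP/cset_inj; rewrite -(setD1K bP') P'Q PA.
rewrite bP PbQ eqxx (cE P b) ?PbQ //; last exact: valid_hits (valid_cset _).
by rewrite mulrAC sg_sqr mul1r.
Qed.

End Lift.

Lemma cellular_lift0 (z : bas C 0 -> S) : (forall Q, z Q \is 1.-homog) -> cyc z ->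
  exists c : bas C 1 -> k, forall Q, z Q = \sum_P c P *: dif P Q.
Proof.
move=> z1 zc.
(* The coefficient of the monomial [m] in the cycle condition. *)
have rel m : \sum_B (if (ind B <= m)%MM then (cycle_at z B)@_(m - ind B) else 0) = 0.
  have : \sum_(Q : bas C 0) z Q * 'X_[ind (cset Q)] = 0.
    by rewrite -[RHS]zc; apply: eq_bigr => Q _; rewrite -cellular_augE.
  rewrite (sum_cycle_at z (fun B => 'X_[ind B])) => /(congr1 (fun p : S => p@_m)).
  rewrite mcoeff0 raddf_sum /= => e; rewrite -[RHS]e.
  by apply: eq_bigr => B _; rewrite mcoeffMXm.
(* The monomial of [B] times a variable of [B] is divisible by no other transversal monomial, so its
   coefficient in the cycle condition is the single value at [B]. *)
have h1 B b : b \in B -> cycle_coef z B b = 0.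
  move=> bB; apply/eqP; case: (boolP (cycle_coef z B b == 0)) => // nz.
  have [vB cB] := cycle_coef_neq0 nz.
  have := rel (ind B + U_(b))%MM; rewrite (bigD1 B) //= lem_addr addmC addmK.
  rewrite big1 ?addr0 => [lB|B' B'B]; first by rewrite -lB eqxx in nz.
  case: mnm_lepP => // H.
  have sB' : B' \subset B.
    apply/fintype.subsetP => a aB'; have := H a.
    rewrite mnmDE mnm1E !indE aB'; case: (boolP (a \in B)) => // aB.
    by rewrite addn0; case: eqP => // ba; rewrite -ba bB in aB.
  rewrite cycle_at_eq0 ?mcoeff0 //; apply/negP => /andP[_ /eqP cB'].
  by case/eqP: B'B; apply/eqP; rewrite eqEcard sB' cB cB' leqnn.
have relA A : #|A| = n.+1 -> \sum_(c in A) cycle_coef z (A :\ c) c = 0.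
  move=> cA; rewrite -[RHS](rel (ind A)); symmetry.
  rewrite (bigID (fun B => [exists c in A, B == A :\ c])) /= [X in _ + X]big1.
    rewrite addr0.
    have inj : {in A &, injective (fun c => A :\ c)}.
      by move=> x y xA yA; exact: setD1_inj.
    rewrite (eq_bigl (mem ((fun c => A :\ c) @: A))) => [|B]; last first.
      apply/exists_inP/imsetP => [[c cA' /eqP->]|[c cA' ->]]; first by exists c.
      by exists c.
    rewrite big_imset //=; apply: eq_bigr => c cA'.
    by rewrite -(ind_D1 cA') lem_addr addmC addmK.
  move=> B /exists_inPn nB; case: mnm_lepP => // H.
  have sB : B \subset A.
    by apply/fintype.subsetP => a aB; have := H a; rewrite !indE aB; case: (a \in A).
  rewrite cycle_at_eq0 ?mcoeff0 //; apply/negP => /andP[_ /eqP cB].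
  have /card_gt0P[c] : (0 < #|A :\: B|)%N.
    by rewrite cardsD (setIidPr sB) cA cB addn0 subSnn.
  rewrite inE => /andP[cB' cA']; have /negP := nB c cA'; apply.
  rewrite eqEcard subsetD1 sB cB' /= (card_D1 cA' cA) cB addn0.
  exact: leqnn.
(* Only the deletions of [a] and [c] leave transversals, so the relation at the squarefree monomial
   of [A] has two terms. *)
have rel2 A a c : #|A| = n.+1 -> a \in A -> c \in A -> a != c -> r a = r c ->
    cycle_coef z (A :\ a) a + cycle_coef z (A :\ c) c = 0.
  move=> cA aA cA' ac rac; rewrite -[RHS](relA A cA).
  rewrite (bigD1 a) // (bigD1 c) /= ?cA' 1?eq_sym //; congr (_ + _).
  rewrite big1 ?addr0 // => d /andP[/andP[dA da] dc].
  apply/eqP; apply: contraTT isT => /cycle_coef_neq0[/valid_hits hd _].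
  by have [e|e] := pair_only cA aA cA' ac rac dA hd; [rewrite e eqxx in da|rewrite e eqxx in dc].
apply: (lift_from z1) => // [B a aB nz|A a c cA aA cA' ac vA ha hc].
  have [vB cB] := cycle_coef_neq0 nz; rewrite addn0 in cB.
  have cA : #|a |: B| = n.+1 by rewrite cardsU1 aB cB.
  have /hitsP/(_ (r a))[y yB ry] := valid_hits vB.
  have ya : a != y by apply: contraNneq aB => ->.
  (* The edge [a |: B] has the vertices [B] and [(a |: B) :\ y], with [y] the element of [B] in the
     row of [a]. By the two-term relation a nonzero coefficient at one forces a nonzero one at the
     other, so both are cells. *)
  have := rel2 (a |: B) a y cA (setU11 _ _) (setU1r _ yB) ya (esym ry).
  rewrite setU1K // => e.
  have /cycle_coef_neq0[vy _] : cycle_coef z ((a |: B) :\ y) y != 0.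
    apply: contraNneq nz => e0.
    by move: e; rewrite e0 addr0 => ->.
  apply: validP => [|T hT cT sT]; first exact: hitsS (subsetU1 a B) (valid_hits vB).
  have /card_gt0P[c] : (0 < #|(a |: B) :\: T|)%N.
    by rewrite cardsD (setIidPr sT) cA cT subSnn.
  rewrite inE => /andP[cT' cAB].
  have eT : T = (a |: B) :\ c.
    by apply/eqP; rewrite eqEcard subsetD1 sT cT' (card_D1 cAB cA) cT leqnn.
  have hc : hits r ((a |: B) :\ c) by rewrite -eT.
  have [e1|e1] := pair_only cA (setU11 _ _) (setU1r _ yB) ya (esym ry) cAB hc.
    by apply: valid_transversal vB _ _ _; rewrite // eT e1 setU1K.
  by apply: valid_transversal vy _ _ _; rewrite // eT e1.
rewrite addn0 in cA.
have rac := pair_class cA aA cA' ac ha hc.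
have /eqP := rel2 A a c cA aA cA' ac rac; rewrite addr_eq0 => /eqP->.
have : sg A a + sg A c = 0 by rewrite /sg -intrD sgn_pair.
by move/eqP; rewrite addr_eq0 => /eqP->; rewrite mulrN mulNr opprK.
Qed.

Lemma cellular_liftS j (z : bas C j.+1 -> S) : (forall Q, z Q \is 1.-homog) -> cyc z ->
  exists c : bas C j.+2 -> k, forall Q, z Q = \sum_P c P *: dif P Q.
Proof.
move=> z1 zc.
(* The component of the boundary of [z] at the cell [E], summed over the variable [a] by which a
   cell above [E] exceeds it. *)
have sumE E : valid r Phi E -> #|E| = (n + j)%N ->
    \sum_a (a \notin E)%:R * (sg (a |: E) a) *: (cycle_at z (a |: E) * 'X_a) = 0.
  move=> vE cE; have [Q QE] := cset_ex vE cE; rewrite -[RHS](zc Q).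
  transitivity (\sum_(Q' : bas C j.+1) z Q' * sdif (cset Q') E); last first.
    by apply: eq_bigr => Q' _; rewrite -QE -cellular_difE.
  rewrite (sum_cycle_at z (fun B => sdif B E)).
  under [RHS]eq_bigr do rewrite mulr_sumr.
  rewrite (exchange_big_dep xpredT) //=; apply: eq_bigr => a _.
  have eqE B : (a \in B) && (B :\ a == E) = (a \notin E) && (B == a |: E).
    apply/andP/andP => [[aB /eqP<-]|[aE /eqP->]].
      by rewrite !inE eqxx setD1K.
    by rewrite setU11 setU1K.
  rewrite (eq_bigl _ _ eqE); case: (boolP (a \in E)) => aE.
    by rewrite mul0r scale0r big_pred0.
  by rewrite mul1r big_pred1_eq -scalerAr.
have rel E b c : valid r Phi E -> #|E| = (n + j)%N -> b != c ->
    (b \notin E)%:R * sg (b |: E) b * cycle_coef z (b |: E) c +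
    (c \notin E)%:R * sg (c |: E) c * cycle_coef z (c |: E) b = 0.
  move=> vE cE bc; have /(congr1 (fun p : S => p@_(U_(b) + U_(c))%MM)) := sumE E vE cE.
  rewrite mcoeff0 raddf_sum /= => e; rewrite -[RHS]e.
  under eq_bigr do rewrite mcoeffZ mcoeffMX_UU //.
  have cb : c != b by rewrite eq_sym.
  rewrite (bigD1 b) // (bigD1 c) //= big1 ?addr0 => [|a /andP[ab ac]].
    by rewrite !eqxx (negPf bc) (negPf cb) !mul1r !mul0r addr0 add0r.
  by rewrite (negPf ab) (negPf ac) !mul0r addr0 mulr0.
have rel0 E b : valid r Phi E -> #|E| = (n + j)%N ->
    (b \notin E)%:R * sg (b |: E) b * cycle_coef z (b |: E) b = 0.
  move=> vE cE; have /(congr1 (fun p : S => p@_(U_(b) + U_(b))%MM)) := sumE E vE cE.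
  rewrite mcoeff0 raddf_sum /= => e; rewrite -[RHS]e.
  under eq_bigr do rewrite mcoeffZ mcoeffMX_U2.
  rewrite (bigD1 b) //= big1 ?addr0 => [|a ab]; first by rewrite eqxx mul1r.
  by rewrite (negPf ab) !mul0r mulr0.
have pairB B : valid r Phi B -> #|B| = (n + j.+1)%N ->
    exists x y, [/\ x \in B, y \in B, x != y & r x = r y].
  by move=> vB cB; apply: same_class_ex (valid_hits vB) _; rewrite cB addnS ltnS leq_addr.
have sub1 B c : valid r Phi B -> #|B| = (n + j.+1)%N -> c \in B -> hits r (B :\ c) ->
    valid r Phi (B :\ c) /\ #|B :\ c| = (n + j)%N.
  move=> vB cB cB' hc; split; first exact: validS (subD1set _ _) hc vB.
  by apply: card_D1 => //; rewrite cB addnS.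
apply: (lift_from z1) => [B b bB|B a aB nz|].
(* Compare at a face [E = B :\ x]. For [b] different from [x], which then lies in [E], the product
   of the variables [x] and [b] arises only from [B]; for [b = x] the square of that variable is
   used. *)
- apply/eqP; case: (boolP (cycle_coef z B b == 0)) => // nz.
  have [vB cB] := cycle_coef_neq0 nz; have [x [y [xB yB xy rxy]]] := pairB B vB cB.
  have [vE cE] := sub1 B x vB cB xB (hitsD1 xB yB xy rxy (valid_hits vB)).
  have [bx|bx] := eqVneq b x.
    have /eqP := rel0 _ x vE cE; rewrite !inE eqxx /= mul1r setD1K // mulf_eq0.
    by rewrite (negPf (sg_neq0 _ _)) -bx /= => /eqP e; rewrite e eqxx in nz.
  have xb : x != b by rewrite eq_sym.
  have /eqP := rel _ x b vE cE xb; rewrite !inE eqxx bx bB /= mul1r !mul0r addr0.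
  rewrite setD1K // mulf_eq0 (negPf (sg_neq0 _ _)) /= => /eqP e.
  by rewrite e eqxx in nz.
- have [vB cB] := cycle_coef_neq0 nz; have [x [y [xB yB xy rxy]]] := pairB B vB cB.
  apply: validP => [|T hT cT sT]; first exact: hitsS (subsetU1 a B) (valid_hits vB).
  (* A transversal [T] cannot contain both [x] and [y], so one of them can be deleted. The relation
     at [B :\ c] then makes [a |: B :\ c] a cell, and this cell contains [T]. *)
  have [c [cB' hc cT']] : exists c, [/\ c \in B, hits r (B :\ c) & c \notin T].
    have [xT|xT] := boolP (x \in T); last first.
      by exists x; split=> //; exact: hitsD1 xB yB xy rxy (valid_hits vB).
    exists y; split=> //; first by apply: hitsD1 yB xB _ _ (valid_hits vB); rewrite // eq_sym.
    apply: contra_neqN xy => yT; exact: transversal_inj hT cT _ _ xT yT rxy.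
  have [vE cE] := sub1 B c vB cB cB' hc.
  have ca : c != a by apply: contraNneq aB => <-.
  have := rel _ c a vE cE ca.
  rewrite !inE eqxx (negPf aB) andbF /= !mul1r setD1K // => e.
  have /cycle_coef_neq0[vA _] : cycle_coef z (a |: B :\ c) c != 0.
    apply: contraNneq nz => e0; move/eqP: e.
    by rewrite e0 mulr0 addr0 mulf_eq0 (negPf (sg_neq0 _ _)).
  apply: valid_transversal vA hT cT _; apply/fintype.subsetP => t tT.
  have := fintype.subsetP sT t tT; rewrite !inE => /orP[->//|tB].
  by rewrite tB andbT orbC; apply/orP; left; apply: contraNneq cT' => <-.
(* The relation at the common face [A :\ a :\ c] has two terms in the product of the variables [a]
   and [c]; [sgn_swap] turns their opposite signs into an equality. *)
have h3 A a c : #|A| = (n + j.+1).+1 -> a \in A -> c \in A -> a != c ->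
    valid r Phi A -> hits r (A :\ a :\ c) ->
    sg A a * cycle_coef z (A :\ a) a = sg A c * cycle_coef z (A :\ c) c.
  move=> cA aA cA' ac vA hE.
  have cAa : c \in A :\ a by rewrite !inE eq_sym ac.
  have aAc : a \in A :\ c by rewrite !inE ac.
  have sE : A :\ a :\ c \subset A by apply: fintype.subset_trans (subD1set _ _) (subD1set _ _).
  have vE := validS sE hE vA.
  have cE : #|A :\ a :\ c| = (n + j)%N.
    by apply: card_D1 => //; rewrite -addnS; exact: card_D1.
  have eE : A :\ a :\ c = A :\ c :\ a by rewrite !setDDl setUC.
  have ca : c != a by rewrite eq_sym.
  have := rel _ c a vE cE ca.
  rewrite setD1K // {3 4}eE setD1K // !inE !eqxx /= andbF !mul1r.
  move/eqP; rewrite addr_eq0 => /eqP e.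
  have sw : sg A a * sg (A :\ a) c = - (sg A c * sg (A :\ c) a).
    by rewrite /sg -!intrM sgn_swap // rmorphN.
  have {}e : cycle_coef z (A :\ a) a = - (sg (A :\ a) c * sg (A :\ c) a * cycle_coef z (A :\ c) c).
    by rewrite -[LHS]mul1r -(sg_sqr (A :\ a) c) -mulrA e mulrN mulrA.
  rewrite e mulrN !mulrA sw !mulNr opprK.
  by rewrite -(mulrA (sg A c)) sg_sqr mulr1.
move=> A a c cA aA cA' ac vA ha hc.
have [|hE] := boolP (hits r (A :\ a :\ c)); first exact: h3.
have cAa : #|A :\ a| = (n + j.+1)%N by apply: card_D1.
have [x [y [xA yA xy rxy]]] :
    exists x y, [/\ x \in A :\ a, y \in A :\ a, x != y & r x = r y].
  by apply: same_class_ex ha _; rewrite cAa addnS ltnS leq_addr.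
(* A has no element of the colour of a and c besides a and c themselves, so x has
   another colour; hence the values at a and at c can both be compared with the one
   at x. *)
have rac : r a = r c.
  apply/eqP; apply: contraNT hE => rac; apply/hitsP => l.
  have [cl|cl] := eqVneq l (r c).
    have /hitsP/(_ l)[d] := hc; rewrite !inE => /andP[dc dA] dl.
    by exists d => //; rewrite !inE dc dA andbT /=; apply: contra_neq rac => <-; rewrite dl.
  have /hitsP/(_ l)[d] := ha; rewrite !inE => /andP[da dA] dl.
  exists d => //; rewrite !inE da dA !andbT.
  by apply: contra_neq cl => <-; rewrite dl.
have rxc : r x != r c.
  apply: contraNneq hE => rxc.
  have [xc|xc] := eqVneq x c.
    have yc : y != c by rewrite -xc eq_sym.
    by rewrite -xc; exact: hitsD1 xA yA xy rxy ha.
  have cAa' : c \in A :\ a by rewrite !inE eq_sym ac.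
  by apply: hitsD1 cAa' xA _ _ ha; rewrite // eq_sym.
have xa : x != a by apply: contraNneq rxc => ->; rewrite rac.
have xc : x != c by apply: contraNneq rxc => ->.
have yc : y != c by apply: contraNneq rxc => <-; rewrite rxy.
have xA' : x \in A by move: xA; rewrite !inE => /andP[].
have yA' : y \in A by move: yA; rewrite !inE => /andP[].
have hcx : hits r (A :\ c :\ x).
  have xAc : x \in A :\ c by rewrite !inE xc.
  have yAc : y \in A :\ c by rewrite !inE yc.
  exact: hitsD1 xAc yAc xy rxy hc.
rewrite (h3 A a x) //; first by rewrite (h3 A c x) // eq_sym.
  by rewrite eq_sym.
exact: hitsD1 xA yA xy rxy ha.
Qed.

Lemma valid_transversal_self T : T \in Phi -> hits r T -> #|T| = n -> valid r Phi T.
Proof.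
move=> TP hT cT; apply: validP => // T' hT' cT' sT'.
by have /eqP-> : T' == T by rewrite eqEcard sT' cT cT' leqnn.
Qed.

(** For an ideal [I] the hypotheses say that its degree [n] part has the monomials of the
    transversals in [Phi] as a basis, and these are the vertices of the complex. *)
Lemma strand_cellular (I : S -> Prop) :
  (forall T, T \in Phi -> hits r T -> #|T| = n -> I 'X_[ind T]) ->
  (forall f m, I f -> f \is n.-homog -> f@_m != 0 ->
     exists T, [/\ T \in Phi, hits r T, #|T| = n & m = ind T]) ->
  strand I n C.
Proof.
move=> HI1 HI2.
have augX (c : bas C 0 -> k) :
    \sum_P c P *: aug P = \sum_P c P *: 'X_[ind (cset P)] :> S.
  by apply: eq_bigr => P _; rewrite -cellular_augE.
split.
- by move=> i P; exact: cellular_deg.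
- by move=> i P Q; rewrite cellular_difE; exact: sdif_homog.
- move=> P; rewrite cellular_augE; have cP := card_cset P; rewrite addn0 in cP.
  split; last by rewrite dhomogX; apply/eqP; rewrite -[RHS]cP; exact: mdeg_ind.
  have vP := valid_cset P; have hP := valid_hits vP.
  by apply: HI1 => //; exact: valid_transversal vP hP cP (subxx _).
- move=> f If fn; exists (fun P => f@_(ind (cset P))); rewrite augX.
  apply/mpolyP => m; rewrite raddf_sum /=.
  under eq_bigr do rewrite mcoeffZ mcoeffX.
  have [fm|fm] := eqVneq f@_m 0.
    rewrite fm big1 // => P _; case: eqP => [->|_]; last by rewrite mulr0.
    by rewrite fm mul0r.
  have [T [TP hT cT mT]] := HI2 f m If fn fm.
  have [P PT] : exists P : bas C 0, cset P = T.
    by apply: cset_ex; [exact: valid_transversal_self | rewrite addn0].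
  rewrite (bigD1 P) //= PT -mT eqxx mulr1 big1 ?addr0 // => P' P'P.
  case: eqP => [e|_]; last by rewrite mulr0.
  by case/eqP: P'P; apply: cset_inj; apply: ind_inj; rewrite e PT.
- move=> c; rewrite augX => c0 P; have := congr1 (fun p : S => p@_(ind (cset P))) c0.
  rewrite mcoeff0 raddf_sum /= (bigD1 P) //= mcoeffZ mcoeffX eqxx mulr1 big1 ?addr0 //.
  move=> P' P'P; rewrite mcoeffZ mcoeffX; case: eqP => [/ind_inj/cset_inj e|_].
    by rewrite e eqxx in P'P.
  by rewrite mulr0.
- by move=> i P; exact: cellular_cyc.
- by case=> [|j] z z1 zc; [exact: cellular_lift0 | exact: cellular_liftS].
- by move=> i c; exact: cellular_inj.
Qed.

End CellularStrand.

(** * Lead monomials of maximal minors *)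

Section LeadMonomials.
Local Open Scope ring_scope.
Variables (k : fieldType) (n m : nat).
Local Notation S := {mpoly k[n * m]}.

(** [mxvec_index] is the rank of a pair in the enumeration of pairs, so [enum_val] recovers row and
    column. *)
Definition var_row (a : 'I_(n * m)) : 'I_n :=
  (enum_val (cast_ord (esym (mxvec_cast n m)) a)).1.

Lemma var_row_mxvec i j : var_row (mxvec_index i j) = i.
Proof. by rewrite /var_row /mxvec_index cast_ordK enum_rankK. Qed.

Lemma mxvec_index_inj i i' j j' :
  mxvec_index i j = mxvec_index i' j' :> 'I_(n * m) -> i = i' /\ j = j'.
Proof. by move/cast_ord_inj/enum_rank_inj => -[]. Qed.

Definition graph_vars (g : 'I_n -> 'I_m) : {set 'I_(n * m)} :=
  [set mxvec_index i (g i) | i : 'I_n].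

Lemma graph_vars_card g : #|graph_vars g| = n.
Proof. by rewrite card_imset ?card_ord // => i j /mxvec_index_inj[]. Qed.

Lemma graph_vars_hits g : hits var_row (graph_vars g).
Proof.
apply/hitsP => i; exists (mxvec_index i (g i)); last exact: var_row_mxvec.
exact: imset_f.
Qed.

Lemma ind_graph_vars g : ind (graph_vars g) = (\sum_i U_(mxvec_index i (g i)))%MM.
Proof.
apply/mnmP => a; rewrite indE mnm_sumE.
case: (boolP (a \in _)) => [/imsetP[i _ ->]|aT].
  rewrite (bigD1 i) //= mnm1E eqxx big1 // => j ji; rewrite mnm1E.
  by case: eqP => // /mxvec_index_inj[e]; rewrite e eqxx in ji.
rewrite big1 // => i _; rewrite mnm1E; case: eqP => // e.
by case/negP: aT; rewrite -e; exact: imset_f.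
Qed.

Lemma det_colsub_generic (h : 'I_n -> 'I_m) :
  \det (colsub h (generic_matrix k n m)) =
  \sum_(s : 'S_n) (-1) ^+ s * 'X_[ind (graph_vars (fun i => h (s i)))].
Proof.
apply: eq_bigr => s _; congr (_ * _); rewrite ind_graph_vars -mprodXE.
by apply: eq_bigr => i _; rewrite !mxE.
Qed.

Lemma minor_generic (a : {set 'I_m}) : #|a| = n ->
  exists2 h : 'I_n -> 'I_m, injective h &
    minor k n a = \det (colsub h (generic_matrix k n m)).
Proof.
rewrite /minor; move: (@enum_val _ (mem a)) (@enum_val_inj _ (mem a)).
(* Once [#|a|] is a variable it can be replaced by [n], and the cast in [conform_mx] disappears. *)
move: #|a| => p h hinj pn; rewrite pn in h hinj *.
by exists h => //; rewrite conform_mx_id.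
Qed.

Lemma minor_msupp (a : {set 'I_m}) u : #|a| = n -> u \in msupp (minor k n a) ->
  exists g, u = ind (graph_vars g).
Proof.
move=> /minor_generic[h _ ->]; rewrite det_colsub_generic mcoeff_msupp raddf_sum /=.
move=> nz; have [s es] : exists s : 'S_n,
    ((-1) ^+ s * 'X_[ind (graph_vars (fun i => h (s i)))] : S)@_u != 0.
  apply/existsP; apply: contraNT nz => /existsPn H.
  by rewrite big1 // => s _; apply/eqP; have := H s; rewrite negbK.
exists (fun i => h (s i)); apply/eqP; apply: contraNT es => ne.
rewrite mulr_sign; case: (odd_perm s); rewrite ?mcoeffN mcoeffX [_ == u]eq_sym (negPf ne) ?oppr0 //.
Qed.

(** The columns are distinct, so different permutations give different monomials and nothing cancels
    the diagonal term. *)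
Lemma minor_neq0 (a : {set 'I_m}) : #|a| = n -> minor k n a != 0.
Proof.
move=> /minor_generic[h hinj ->]; rewrite det_colsub_generic; apply/eqP.
move/(congr1 (fun p : S => p@_(ind (graph_vars h)))).
rewrite mcoeff0 raddf_sum /= (bigD1 1%g) //= odd_perm1 expr0 mul1r.
have -> : graph_vars (fun i => h ((1%g : 'S_n) i)) = graph_vars h.
  by apply: eq_imset => i; rewrite perm1.
rewrite mcoeffX eqxx big1 ?addr0 => [/eqP|s s1]; first by rewrite oner_eq0.
suff ne : ind (graph_vars (fun i => h (s i))) != ind (graph_vars h).
  by rewrite mulr_sign; case: (odd_perm s); rewrite ?mcoeffN mcoeffX (negPf ne) ?oppr0.
apply: contra_neq s1 => /ind_inj/setP e; apply/permP => i; rewrite perm1.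
have : mxvec_index i (h (s i)) \in graph_vars h.
  by rewrite -e; exact: (imset_f (fun i => mxvec_index i (h (s i)))).
by case/imsetP=> j _ /mxvec_index_inj[-> /hinj].
Qed.

Variable le : rel 'X_{1..(n * m)}.
Hypothesis le_term : term_order le.

Lemma lead_monomial_msupp (f : S) : f != 0 -> lead_monomial le f \in msupp f.
Proof.
have [_ anti _ _ [le0 _]] := le_term.
rewrite -msupp_eq0 /lead_monomial; elim: (msupp f : seq _) => // u s IH _.
rewrite big_cons; case: ifP => ule; last exact: mem_head.
(* On an empty tail the maximum is the default [0%MM], which need not be in the support; but then
   [u] is at most [0%MM], hence equal to it. *)
have [s0|s0] := eqVneq s [::]; last by rewrite inE IH ?orbT.
move: ule; rewrite s0 big_nil => ule.
by have -> : 0%MM = u by [apply: anti; rewrite le0 ule]; exact: mem_head.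
Qed.

Lemma lead_monomial_minor (a : {set 'I_m}) : #|a| = n ->
  exists g, lead_monomial le (minor k n a) = ind (graph_vars g).
Proof.
by move=> ca; apply: (minor_msupp ca); apply: lead_monomial_msupp; exact: minor_neq0.
Qed.

End LeadMonomials.

(** A face of largest cardinality is a facet, and purity gives all facets its size. *)
Lemma pure_facet_card (T : finType) (D : {set {set T}}) :
  simplicial_complex D -> pure D ->
  (exists a, facet D a) /\ forall a, facet D a -> #|a| = dim1 D.
Proof.
move=> [D0 _] pD.
have [a aD ea] : {a | a \in D & dim1 D = #|a|}.
  by apply: eq_bigmax_cond; apply/card_gt0P; exists finset.set0.
have fa : facet D a.
  apply/maxsetP; split=> // B BD sB; apply/eqP; rewrite eq_sym eqEcard sB -ea.
  exact: (@leq_bigmax_cond _ (mem D) (fun b : {set T} => #|b|)).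
by split=> [|b fb]; [exists a | rewrite ea; exact: pD].
Qed.

(** When all generators are linear the strand differs from [F] only by the subtype wrapping of its
    bases. *)
Lemma gfree_iso_full_strand (k : fieldType) (N n : nat) (G F : gfree k N) :
  (forall i (p : bas F i), gdeg p = (n + i)%N) ->
  gfree_iso G (linear_strand n F) -> gfree_iso G F.
Proof.
move=> degF [phi [psi [H1 H2 H3 H4 H5]]].
have dF i (q : bas F i) : gdeg q == (n + i)%N by apply/eqP.
pose s i (q : bas F i) : bas (linear_strand n F) i := exist _ q (dF i q).
have sum_s i (h : bas (linear_strand n F) i -> {mpoly k[N]}) :
    (\sum_q h q = \sum_q h (s i q))%R.
  rewrite (reindex (s i)) //; apply: onW_bij; exists val => q //.
  exact: val_inj.
exists (fun i p q => phi i p (s i q)), (fun i q p => psi i (s i q) p); split.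
- by move=> i p q; exact: H1.
- by move=> i p p'; rewrite -H2 [RHS]sum_s.
- by move=> i q q'; rewrite H3; congr (nat_of_bool _)%:R%R; apply/eqP/eqP => [[]|->].
- by move=> i p q'; rewrite H4 sum_s.
- by move=> p; rewrite H5 sum_s.
Qed.

(** * The strand of the rainbow ideal *)

Section RainbowStrand.
Local Open Scope ring_scope.
Variables (R : realType) (k : fieldType) (n m : nat).
Variables (le : rel 'X_{1..(n * m)}) (D : {set {set 'I_m}}).
Hypotheses (le_term : term_order le) (D_complex : simplicial_complex D).
Hypotheses (D_pure : pure D) (D_dim : dim1 D = n).
Local Notation I := (rain (k := k) le D).
Local Notation lead a := (lead_monomial le (minor k n a)).

Let facet_card a : facet D a -> #|a| = n.
Proof. by rewrite -D_dim; have [_] := pure_facet_card D_complex D_pure; exact. Qed.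

Let rain_lead a : facet D a -> I 'X_[lead a].
Proof.
move=> fa; exists (fun b => (b == a)%:R).
by rewrite (bigD1 a) //= eqxx mul1r big1 ?addr0 // => b /andP[_ /negPf->]; rewrite mul0r.
Qed.

Let mdeg_lead a : facet D a -> mdeg (lead a) = n.
Proof.
move=> /facet_card/(lead_monomial_minor k le_term)[g ->].
by rewrite mdeg_ind graph_vars_card.
Qed.

Let rain_msupp f u : I f -> f@_u != 0 -> exists2 a, facet D a & (lead a <= u)%MM.
Proof.
move=> [c ->]; rewrite raddf_sum /= => nz.
have [a] : exists a, facet D a && ((c a * 'X_[lead a])@_u != 0).
  apply/existsP; apply: contraNT nz => /existsPn H.
  by apply/eqP/big1 => a fa; apply/eqP; have := H a; rewrite fa negbK.
case/andP=> fa; rewrite mcoeffMXm; case: ifP => [la _|_]; first by exists a.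
by rewrite eqxx.
Qed.

(** A facet exists and its lead monomial has degree [n]; conversely every monomial of an element of
    the ideal is divisible by such a monomial. *)
Lemma rain_initial_degree d : initial_degree I d -> d = n.
Proof.
case=> [[f [If f0 fd]] dmin]; apply/anti_leq/andP; split.
  have [[a fa] _] := pure_facet_card D_complex D_pure.
  apply: (dmin _ 'X_[lead a]); first exact: rain_lead.
    by rewrite -msupp_eq0 msuppX.
  by rewrite dhomogX; apply/eqP; exact: mdeg_lead.
have [u uf] : exists u, u \in msupp f.
  move: f0; rewrite -msupp_eq0; case: (msupp f : seq _) => // u s _.
  by exists u; exact: mem_head.
have [a fa la] : exists2 a, facet D a & (lead a <= u)%MM.
  by apply: rain_msupp If _; rewrite -mcoeff_msupp.
have := mdegD (u - lead a)%MM (lead a).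
by rewrite submK // (dhomog_mf fd uf) mdeg_lead // => ->; exact: leq_addl.
Qed.

Let Phi : {set {set 'I_(n * m)}} :=
  [set T | [exists a, facet D a && (ind T == lead a)]].

Lemma rain_strand :
  strand I n (cellular k (@cell_incid _ _ (@var_row n m) R Phi)
                (@cell_lab _ _ (@var_row n m) R Phi)).
Proof.
apply: strand_cellular => [T|f u If fn fu].
  by rewrite inE => /existsP[a /andP[fa /eqP->]] _ _; exact: rain_lead.
have [a fa la] := rain_msupp If fu.
have [g eg] := lead_monomial_minor k le_term (facet_card fa).
(* A degree [n] monomial divisible by a generator of degree [n] equals it. *)
have eu : u = lead a.
  have du : mdeg u = n by apply/eqP; apply: contraNT fu => /(dhomog_nemf_coeff fn)->.
  have := mdegD (u - lead a)%MM (lead a).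
  rewrite submK // du mdeg_lead // -{1}[n]add0n => /addIn/esym/eqP.
  by rewrite mdeg_eq0 => /eqP e; rewrite -(submK la) e add0m.
exists (graph_vars g); split; [|exact: graph_vars_hits|exact: graph_vars_card|].
  by rewrite inE; apply/existsP; exists a; rewrite fa -eg eqxx.
by rewrite eu.
Qed.

Lemma rain_supported F d : minimal_graded_resolution I F -> initial_degree I d ->
  exists X (eps : cell X -> cell X -> int) (lab : cell X -> 'X_{1..(n * m)}),
    incidence eps /\ gfree_iso (@cellular k _ R X eps lab) (linear_strand n F).
Proof.
move=> FI Id; exists _, (@cell_incid _ _ (@var_row n m) R Phi), (@cell_lab _ _ _ R Phi).
split; first exact: incidence_cell_incid.
apply: strand_iso rain_strand _; apply: strand_linear_strand => //.
by have := Id; rewrite {1}(rain_initial_degree Id).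
Qed.

End RainbowStrand.

Theorem corollary4p13 (R : realType) (k : fieldType) (n m : nat)
    (le : rel 'X_{1..(n * m)}) (D : {set {set 'I_m}}) :
  (n <= m)%N -> term_order le ->
  simplicial_complex D -> pure D -> dim1 D = n ->
  (forall (F : gfree k (n * m)) (d : nat),
     minimal_graded_resolution (rain le D) F ->
     initial_degree (rain (k := k) le D) d ->
     supported_on_regularCW R (linear_strand d F)) /\
  (has_linear_resolution (rain (k := k) le D) ->
   has_CW_resolution R (rain (k := k) le D)).
Proof.
move=> _ le_term D_complex D_pure D_dim; split=> [F d FI Id|[F [d [FI Id degF]]]].
  rewrite (rain_initial_degree le_term D_complex D_pure D_dim Id).
  exact: rain_supported FI Id.
have dn := rain_initial_degree le_term D_complex D_pure D_dim Id.
(* The given linear resolution is its own linear strand, so the first part already supports all of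
   it. *)
exists F; split=> //.
have [X [eps [lab [Heps iso]]]] :=
  rain_supported R le_term D_complex D_pure D_dim FI Id.
exists X, eps, lab; split=> //; apply: gfree_iso_full_strand iso => i p.
by rewrite degF dn.
Qed.
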